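(* Let $p\ge 2$, $q=e^{\pi i/p}$ and $1\le s\le p-1$. The basic algebra $B_s=(e_s^{+}+e_{p-s}^{-})\,\mathcal{Q}_s\,(e_s^{+}+e_{p-s}^{-})$ is an $8$-dimensional associative algebra with basis $$e_s^{+},\ e_{p-s}^{-},\ X_0^{+},\ X_0^{-},\ Y_0^{+},\ Y_0^{-},\ A_0^{+},\ A_0^{-},$$ and the products $xy$ of basis elements are as follows: $$e_s^+e_s^+=e_s^+,\quad e_{p-s}^-e_{p-s}^-=e_{p-s}^-,$$ $$e_s^+A_0^+=A_0^+e_s^+=A_0^+,\quad e_{p-s}^-A_0^-=A_0^-e_{p-s}^-=A_0^-,$$ $$X_0^+e_s^+=X_0^+=e_{p-s}^-X_0^+,\quad Y_0^+e_s^+=Y_0^+=e_{p-s}^-Y_0^+,$$ $$X_0^-e_{p-s}^-=X_0^-=e_s^+X_0^-,\quad Y_0^-e_{p-s}^-=Y_0^-=e_s^+Y_0^-,$$ $$X_0^+Y_0^-=Y_0^+X_0^-=A_0^-,\quad X_0^-Y_0^+=Y_0^-X_0^+=A_0^+,$$ and all other products $xy$ of two elements of this basis are $0$.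
   Context: $\overline{U}_q=\overline{U}_qsl_2(\mathbb{C})$ is the associative unital $\mathbb{C}$-algebra generated by $E,F,K$ with relations $E^p=F^p=0$, $K^{2p}=1$, $KEK^{-1}=q^2E$, $KFK^{-1}=q^{-2}F$, $EF-FE=\frac{K-K^{-1}}{q-q^{-1}}$. Put $[n]=\frac{q^n-q^{-n}}{q-q^{-1}}$. Upper signs go together and lower signs go together; empty products are $1$, empty sums are $0$. For $1\le s\le p-1$ put $v_s^{\pm}=\sum_{\ell=0}^{2p-1}(\pm q^{-(s-1)})^{\ell}K^{\ell}$, $a_0^{\pm}(s)=E^{p-1}F^{p-1}v_s^{\pm}$, $$\alpha_n^{\pm}(s)=\prod_{k=p-s-(n-1)}^{p-s-1}(\mp[k][p-s-k]),\qquad b_0^{\pm}(s)=\sum_{n=1}^{p-s}\alpha_n^{\pm}(s)E^{p-1-n}F^{p-1-n}v_s^{\pm},$$ $$\gamma^{\pm}(s)=2p\prod_{m=1}^{p-s-1}(\mp[m][p-s-m])\prod_{i=1}^{s-1}(\pm[i][s-i]),$$ $$\delta^{\pm}(s)=2p\prod_{m=1}^{p-s-1}(\mp[m][p-s-m])\sum_{j=1}^{s-1}\prod_{1\le k\le s-1,\,k\ne j}(\pm[k][s-k])+2p\prod_{i=1}^{s-1}(\pm[i][s-i])\sum_{n=1}^{p-s-1}\prod_{1\le k\le p-s-1,\,k\ne n}(\mp[k][p-s-k]),$$ $$e_s^{\pm}=\frac{1}{\gamma^{\pm}(s)}\Big(b_0^{\pm}(s)-\frac{\delta^{\pm}(s)}{\gamma^{\pm}(s)}a_0^{\pm}(s)\Big).$$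 These are primitive idempotents of $\overline{U}_q$. The Casimir element $C=EF+\frac{q^{-1}K+qK^{-1}}{(q-q^{-1})^2}$ is central, with minimal polynomial $(x-\beta_0)(x-\beta_p)\prod_{j=1}^{p-1}(x-\beta_j)^2$, $\beta_j=\frac{q^j+q^{-j}}{(q-q^{-1})^2}$. Accordingly $\overline{U}_q=\bigoplus_{s=0}^{p}\mathcal{Q}_s$, where $\mathcal{Q}_s$ is the subalgebra (two-sided ideal) of $\overline{U}_q$ on which $C$ has the (generalized) eigenvalue $\beta_s$. One has $e_s^{+},e_{p-s}^{-}\in\mathcal{Q}_s$ for $1\le s\le p-1$. For fixed $s$ with $1\le s\le p-1$ define $$X_0^{+}=\frac{1}{\prod_{\ell=1}^{p-s-1}(-[\ell][p-s-\ell])}E^{p-s}e_s^{+},\quad Y_0^{+}=F^{s}e_s^{+},\quad A_0^{+}=FEe_s^{+},$$ $$X_0^{-}=\frac{1}{\prod_{\ell=1}^{s-1}[\ell][s-\ell]}E^{s}e_{p-s}^{-},\quad Y_0^{-}=F^{p-s}e_{p-s}^{-},\quad A_0^{-}=FEe_{p-s}^{-}.$$ *)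

(* Defs.v *)
From HB Require Import structures.
From mathcomp Require Import all_boot all_order all_algebra.
From mathcomp Require Import all_classical all_reals all_analysis.
From mathcomp Require Import complex.

Set Implicit Arguments.
Unset Strict Implicit.
Unset Printing Implicit Defensive.

Import Order.TTheory GRing.Theory Num.Theory.

Local Open Scope ring_scope.
Local Open Scope quotient_scope.

(** The restricted quantum group [Uq q hp], constructed as the quotient of the
    noncommutative polynomial expressions in E, F, K over the field C by the
    smallest congruence containing the axioms of unital associative C-algebras
    and the defining relations. *)

Inductive qexpr (C : Type) : Type :=
  | GenE | GenF | GenK
  | Scal of C
  | Add of qexpr C & qexpr C
  | Mul of qexpr C & qexpr C.

Arguments GenE {C}.
Arguments GenF {C}.
Arguments GenK {C}.

HB.instance Definition _ (C : Type) := gen_eqMixin (qexpr C).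
HB.instance Definition _ (C : Type) := gen_choiceMixin (qexpr C).

Section Presentation.
Variables (C : fieldType) (p : nat) (q : C).

Local Notation expr := (qexpr C).
Local Notation Opp x := (Mul (Scal (-1)) x).

Definition Pow (x : expr) (n : nat) : expr := iter n (Mul x) (Scal 1).

(* K ^ (2 p) = 1, so that the inverse of K is K ^ (2 p - 1). *)
Definition GenKinv : expr := Pow GenK (2 * p - 1).

Inductive ueq : expr -> expr -> Prop :=
  (* congruence *)
  | ueq_refl x : ueq x x
  | ueq_sym x y : ueq x y -> ueq y x
  | ueq_trans y x z : ueq x y -> ueq y z -> ueq x z
  | ueq_add x x' y y' : ueq x x' -> ueq y y' -> ueq (Add x y) (Add x' y')
  | ueq_mul x x' y y' : ueq x x' -> ueq y y' -> ueq (Mul x y) (Mul x' y')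
  (* unital associative C-algebra *)
  | ueq_addA x y z : ueq (Add x (Add y z)) (Add (Add x y) z)
  | ueq_addC x y : ueq (Add x y) (Add y x)
  | ueq_add0 x : ueq (Add (Scal 0) x) x
  | ueq_addN x : ueq (Add (Opp x) x) (Scal 0)
  | ueq_mulA x y z : ueq (Mul x (Mul y z)) (Mul (Mul x y) z)
  | ueq_mul1l x : ueq (Mul (Scal 1) x) x
  | ueq_mul1r x : ueq (Mul x (Scal 1)) x
  | ueq_mulDl x y z : ueq (Mul (Add x y) z) (Add (Mul x z) (Mul y z))
  | ueq_mulDr x y z : ueq (Mul x (Add y z)) (Add (Mul x y) (Mul x z))
  | ueq_scalD a b : ueq (Scal (a + b)) (Add (Scal a) (Scal b))
  | ueq_scalM a b : ueq (Scal (a * b)) (Mul (Scal a) (Scal b))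
  | ueq_scalC a x : ueq (Mul (Scal a) x) (Mul x (Scal a))
  (* defining relations *)
  | ueq_Ep : ueq (Pow GenE p) (Scal 0)
  | ueq_Fp : ueq (Pow GenF p) (Scal 0)
  | ueq_K2p : ueq (Pow GenK (2 * p)) (Scal 1)
  | ueq_KE : ueq (Mul (Mul GenK GenE) GenKinv) (Mul (Scal (q ^+ 2)) GenE)
  | ueq_KF : ueq (Mul (Mul GenK GenF) GenKinv) (Mul (Scal (q ^- 2)) GenF)
  | ueq_EF : ueq (Add (Mul GenE GenF) (Opp (Mul GenF GenE)))
                 (Mul (Scal (q - q^-1)^-1) (Add GenK (Opp GenKinv))).

Definition ueqb : rel expr := fun x y => `[< ueq x y >].

Lemma ueqb_refl : reflexive ueqb.
Proof. by move=> x; apply/asboolP/ueq_refl. Qed.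

Lemma ueqb_sym : symmetric ueqb.
Proof. by move=> x y; apply/asboolP/asboolP; apply: ueq_sym. Qed.

Lemma ueqb_trans : transitive ueqb.
Proof.
by move=> y x z /asboolP xy /asboolP yz; apply/asboolP/(ueq_trans xy yz).
Qed.

Canonical ueqb_equiv := EquivRel ueqb ueqb_refl ueqb_sym ueqb_trans.

(* The hypothesis makes the algebra nontrivial. *)
Definition Uq of (1 < p)%N := {eq_quot ueqb_equiv}.

End Presentation.

Section Algebra.
Variables (C : fieldType) (p : nat) (q : C) (hp : (1 < p)%N).

Local Notation U := (Uq q hp).
Local Notation Q := {eq_quot (ueqb_equiv p q)}.

HB.instance Definition _ := Choice.on U.

Definition uclass (x : qexpr C) : U := \pi_Q x.
Definition urepr (x : U) : qexpr C := repr (x : Q).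

Lemma ureprK x : uclass (urepr x) = x.
Proof. exact: (@reprK _ Q). Qed.

Lemma uclassP x y : uclass x = uclass y <-> ueq p q x y.
Proof.
split=> [/(@eqquotP _ _ Q) /asboolP //|xy].
by apply/(@eqquotP _ _ Q)/asboolP.
Qed.

Lemma urepr_class x : ueq p q (urepr (uclass x)) x.
Proof. by apply/uclassP; rewrite ureprK. Qed.

Lemma uclassW (P : U -> Prop) : (forall x, P (uclass x)) -> forall x, P x.
Proof. by move=> Px x; rewrite -(ureprK x). Qed.

Definition uadd (x y : U) : U := uclass (Add (urepr x) (urepr y)).
Definition umul (x y : U) : U := uclass (Mul (urepr x) (urepr y)).
Definition uscal (a : C) : U := uclass (Scal a).
Definition uopp (x : U) : U := umul (uscal (-1)) x.
Definition uscale (a : C) (x : U) : U := umul (uscal a) x.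

Lemma uaddE x y : uadd (uclass x) (uclass y) = uclass (Add x y).
Proof. by apply/uclassP; apply: ueq_add; apply: urepr_class. Qed.

Lemma umulE x y : umul (uclass x) (uclass y) = uclass (Mul x y).
Proof. by apply/uclassP; apply: ueq_mul; apply: urepr_class. Qed.

Lemma uaddA : associative uadd.
Proof.
elim/uclassW=> x; elim/uclassW=> y; elim/uclassW=> z.
by rewrite !uaddE; apply/uclassP/ueq_addA.
Qed.

Lemma uaddC : commutative uadd.
Proof.
by elim/uclassW=> x; elim/uclassW=> y; rewrite !uaddE; apply/uclassP/ueq_addC.
Qed.

Lemma uadd0 : left_id (uscal 0) uadd.
Proof. by elim/uclassW=> x; rewrite uaddE; apply/uclassP/ueq_add0. Qed.

Lemma uaddN : left_inverse (uscal 0) uopp uadd.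
Proof.
by elim/uclassW=> x; rewrite /uopp umulE uaddE; apply/uclassP/ueq_addN.
Qed.

HB.instance Definition _ := GRing.isZmodule.Build U uaddA uaddC uadd0 uaddN.

Lemma umulA : associative umul.
Proof.
elim/uclassW=> x; elim/uclassW=> y; elim/uclassW=> z.
by rewrite !umulE; apply/uclassP/ueq_mulA.
Qed.

Lemma umul1l : left_id (uscal 1) umul.
Proof. by elim/uclassW=> x; rewrite umulE; apply/uclassP/ueq_mul1l. Qed.

Lemma umul1r : right_id (uscal 1) umul.
Proof. by elim/uclassW=> x; rewrite umulE; apply/uclassP/ueq_mul1r. Qed.

Lemma umulDl : left_distributive umul uadd.
Proof.
elim/uclassW=> x; elim/uclassW=> y; elim/uclassW=> z.
by rewrite !(umulE, uaddE); apply/uclassP/ueq_mulDl.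
Qed.

Lemma umulDr : right_distributive umul uadd.
Proof.
elim/uclassW=> x; elim/uclassW=> y; elim/uclassW=> z.
by rewrite !(umulE, uaddE); apply/uclassP/ueq_mulDr.
Qed.

(* The counit (E, F, K |-> 0, 0, 1) witnesses that the algebra is nonzero. *)
Fixpoint ucounit (x : qexpr C) : C :=
  match x with
  | GenE | GenF => 0
  | GenK => 1
  | Scal a => a
  | Add x y => ucounit x + ucounit y
  | Mul x y => ucounit x * ucounit y
  end.

Lemma ucounit_pow x n : ucounit (Pow x n) = ucounit x ^+ n.
Proof. by elim: n => // n IHn; rewrite /= IHn exprS. Qed.

Lemma ucounit_ueq x y : ueq p q x y -> ucounit x = ucounit y.
Proof.
have p0 : (p == 0)%N = false by case: p hp.
elim=> //=.
- by move=> {}y {}x z _ -> _ ->.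
- by move=> {}x x' {}y y' _ -> _ ->.
- by move=> {}x x' {}y y' _ -> _ ->.
- by move=> *; rewrite addrA.
- by move=> *; rewrite addrC.
- by move=> *; rewrite add0r.
- by move=> *; rewrite mulN1r addNr.
- by move=> *; rewrite mulrA.
- by move=> *; rewrite mul1r.
- by move=> *; rewrite mulr1.
- by move=> *; rewrite mulrDl.
- by move=> *; rewrite mulrDr.
- by move=> *; rewrite mulrC.
- by rewrite ucounit_pow /= expr0n p0.
- by rewrite ucounit_pow /= expr0n p0.
- by rewrite ucounit_pow /= expr1n.
- by rewrite !(mul0r, mulr0).
- by rewrite !(mul0r, mulr0).
- by rewrite ucounit_pow /= expr1n !(mul0r, mulr0) mulN1r subrr mulr0 addr0.
Qed.

Lemma uone_neq0 : uscal 1 != uscal 0.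
Proof.
by apply/eqP => /uclassP /ucounit_ueq /= /eqP; rewrite oner_eq0.
Qed.

HB.instance Definition _ := GRing.Zmodule_isNzRing.Build U
  umulA umul1l umul1r umulDl umulDr uone_neq0.

Lemma uscaleA a b x : uscale a (uscale b x) = uscale (a * b) x.
Proof.
rewrite /uscale umulA; congr umul; rewrite umulE.
by apply/esym/uclassP/ueq_scalM.
Qed.

Lemma uscale1 : left_id 1 uscale.
Proof. exact: umul1l. Qed.

Lemma uscaleDr : right_distributive uscale +%R.
Proof. by move=> a x y; apply: umulDr. Qed.

Lemma uscaleDl x : {morph uscale^~ x : a b / a + b}.
Proof.
move=> a b; rewrite /uscale -[RHS]umulDl uaddE; congr umul.
by apply/uclassP/ueq_scalD.
Qed.

HB.instance Definition _ := GRing.Zmodule_isLmodule.Build C U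
  uscaleA uscale1 uscaleDr uscaleDl.

Lemma uscaleAl a (x y : U) : a *: (x * y) = (a *: x) * y.
Proof. exact: umulA. Qed.

HB.instance Definition _ := GRing.Lmodule_isLalgebra.Build C U uscaleAl.

Lemma uscaleAr a (x y : U) : a *: (x * y) = x * (a *: y).
Proof.
have scalC (z : U) : umul (uscal a) z = umul z (uscal a).
  by elim/uclassW: z => z; rewrite !umulE; apply/uclassP/ueq_scalC.
by rewrite -[LHS]/(umul (uscal a) (umul x y)) umulA scalC -umulA.
Qed.

HB.instance Definition _ := GRing.Lalgebra_isAlgebra.Build C U uscaleAr.

Definition uE : U := uclass GenE.
Definition uF : U := uclass GenF.
Definition uK : U := uclass GenK.
Definition uKinv : U := uK ^+ (2 * p - 1).

Lemma uclass_add x y : uclass (Add x y) = uclass x + uclass y.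
Proof. by rewrite -uaddE. Qed.

Lemma uclass_mul x y : uclass (Mul x y) = uclass x * uclass y.
Proof. by rewrite -umulE. Qed.

Lemma uclass_scal a : uclass (Scal a) = a *: 1.
Proof. exact/esym/umul1r. Qed.

Lemma uclass_scale a x : uclass (Mul (Scal a) x) = a *: uclass x.
Proof. by rewrite -umulE. Qed.

Lemma uclass_pow x n : uclass (Pow x n) = uclass x ^+ n.
Proof. by elim: n => // n IHn; rewrite [Pow _ _]/= uclass_mul IHn exprS. Qed.

Lemma uKKinv : uK * uKinv = 1.
Proof.
rewrite -exprS subn1 prednK ?muln_gt0 ?(ltnW hp) // -uclass_pow.
exact/uclassP/ueq_K2p.
Qed.

(** The relations hold in [Uq q hp], which is generated by E, F, K and universal
    for these relations. *)

Lemma Uq_relations :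
  [/\ uE ^+ p = 0, uF ^+ p = 0 & uK ^+ (2 * p) = 1] /\
  [/\ uK * uE * uKinv = q ^+ 2 *: uE,
      uK * uF * uKinv = q ^- 2 *: uF &
      uE * uF - uF * uE = (q - q^-1)^-1 *: (uK - uKinv)].
Proof.
have E := (uclass_add, uclass_scale, uclass_mul, uclass_pow).
rewrite /uKinv; split; split.
- by rewrite -uclass_pow; apply/uclassP/ueq_Ep.
- by rewrite -uclass_pow; apply/uclassP/ueq_Fp.
- by rewrite -uclass_pow; apply/uclassP/ueq_K2p.
- by move: (@ueq_KE C p q) => /uclassP; rewrite !E.
- by move: (@ueq_KF C p q) => /uclassP; rewrite !E.
- by move: (@ueq_EF C p q) => /uclassP; rewrite !E !scaleN1r.
Qed.

Lemma Uq_ind (P : U -> Prop) :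
    P uE -> P uF -> P uK -> (forall a, P (a *: 1)) ->
    (forall x y, P x -> P y -> P (x + y)) ->
    (forall x y, P x -> P y -> P (x * y)) ->
  forall x, P x.
Proof.
move=> PE PF PK Ps PD PM; elim/uclassW; elim=> //.
- by move=> a; rewrite uclass_scal.
- by move=> x Px y Py; rewrite uclass_add; apply: PD.
- by move=> x Px y Py; rewrite uclass_mul; apply: PM.
Qed.

Section Universal.
Variables (A : algType C) (e f k : A).

Fixpoint ueval (x : qexpr C) : A :=
  match x with
  | GenE => e | GenF => f | GenK => k
  | Scal a => a *: 1
  | Add x y => ueval x + ueval y
  | Mul x y => ueval x * ueval y
  end.

Lemma ueval_pow x n : ueval (Pow x n) = ueval x ^+ n.
Proof. by elim: n => [|n IHn] /=; rewrite ?scale1r // IHn exprS. Qed.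

Hypotheses (ep : e ^+ p = 0) (fp : f ^+ p = 0) (kp : k ^+ (2 * p) = 1).
Hypothesis ke : k * e * k ^+ (2 * p - 1) = q ^+ 2 *: e.
Hypothesis kf : k * f * k ^+ (2 * p - 1) = q ^- 2 *: f.
Hypothesis ef : e * f - f * e = (q - q^-1)^-1 *: (k - k ^+ (2 * p - 1)).

Lemma ueval_ueq x y : ueq p q x y -> ueval x = ueval y.
Proof.
elim=> //=; rewrite ?ueval_pow /= ?mulr_algl ?scale0r ?scale1r //.
- by move=> {}y {}x z _ -> _ ->.
- by move=> {}x x' {}y y' _ -> _ ->.
- by move=> {}x x' {}y y' _ -> _ ->.
- by move=> *; rewrite addrA.
- by move=> *; rewrite addrC.
- by move=> *; rewrite add0r.
- by move=> *; rewrite mulr_algl scaleN1r addNr.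
- by move=> *; rewrite mulrA.
- by move=> *; rewrite mul1r.
- by move=> *; rewrite mulr1.
- by move=> *; rewrite mulrDl.
- by move=> *; rewrite mulrDr.
- by move=> *; rewrite scalerDl.
- by move=> *; rewrite mulr_algl scalerA.
- by move=> *; rewrite mulr_algl mulr_algr.
- by rewrite !(mulr_algl, scaleN1r).
Qed.

Lemma Uq_universal :
  exists h : {lrmorphism U -> A}, [/\ h uE = e, h uF = f & h uK = k].
Proof.
pose h (x : U) := ueval (urepr x).
have hE x : h (uclass x) = ueval x by apply: ueval_ueq; apply: urepr_class.
have hD : zmod_morphism h.
  elim/uclassW=> x; elim/uclassW=> y; rewrite -scaleN1r -uclass_scale.
  by rewrite -uclass_add !hE /= mulr_algl scaleN1r.
have hM : monoid_morphism h.
  split; first by rewrite hE /= scale1r.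
  by elim/uclassW=> x; elim/uclassW=> y; rewrite -uclass_mul !hE.
have hZ : scalable h.
  by move=> a; elim/uclassW=> x; rewrite -uclass_scale !hE /= mulr_algl.
pose m1 := GRing.isZmodMorphism.Build U A h hD.
pose m2 := GRing.isMonoidMorphism.Build U A h hM.
pose m3 := GRing.isScalable.Build C U A *:%R h hZ.
pose hh : {lrmorphism U -> A} := HB.pack h m1 m2 m3.
by exists hh; rewrite /= !hE.
Qed.

End Universal.

End Algebra.

Arguments uE {C p q hp}.
Arguments uF {C p q hp}.
Arguments uK {C p q hp}.
Arguments uKinv {C p q hp}.

(** Idempotents, blocks and basic algebras. A sign is encoded by a boolean [b],
    with [false] for the upper sign and [true] for the lower sign, so that the
    symbols [±] and [∓] become [(-1) ^+ b] and [- (-1) ^+ b]. *)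

Section Idempotents.
Variables (C : fieldType) (p : nat) (q : C) (hp : (1 < p)%N).

Local Notation U := (Uq q hp).
Implicit Types (b : bool) (s n j : nat).

Definition qint n : C := (q ^+ n - q ^- n) / (q - q^-1).

Definition vsum b s : U :=
  \sum_(0 <= l < 2 * p) ((-1) ^+ b * q ^- (s - 1)) ^+ l *: uK ^+ l.

Definition a0 b s : U := uE ^+ (p - 1) * uF ^+ (p - 1) * vsum b s.

Definition alpha b s n : C :=
  \prod_(p - s - (n - 1) <= k < p - s)
     (- (-1) ^+ b * (qint k * qint (p - s - k))).

Definition b0 b s : U :=
  \sum_(1 <= n < (p - s).+1)
     alpha b s n *: (uE ^+ (p - 1 - n) * uF ^+ (p - 1 - n) * vsum b s).

Definition gamma b s : C :=
  (2 * p)%:R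
  * (\prod_(1 <= m < p - s) (- (-1) ^+ b * (qint m * qint (p - s - m))))
  * (\prod_(1 <= i < s) ((-1) ^+ b * (qint i * qint (s - i)))).

Definition delta b s : C :=
  (2 * p)%:R
  * (\prod_(1 <= m < p - s) (- (-1) ^+ b * (qint m * qint (p - s - m))))
  * (\sum_(1 <= j < s)
       \prod_(1 <= k < s | k != j) ((-1) ^+ b * (qint k * qint (s - k))))
  + (2 * p)%:R
  * (\prod_(1 <= i < s) ((-1) ^+ b * (qint i * qint (s - i))))
  * (\sum_(1 <= n < p - s)
       \prod_(1 <= k < p - s | k != n)
          (- (-1) ^+ b * (qint k * qint (p - s - k)))).

Definition idem b s : U :=
  (gamma b s)^-1 *: (b0 b s - (delta b s / gamma b s) *: a0 b s).

Definition casimir : U :=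
  uE * uF + ((q - q^-1) ^+ 2)^-1 *: (q^-1 *: uK + q *: uKinv).

Definition beta j : C := (q ^+ j + q ^- j) / (q - q^-1) ^+ 2.

(* The generalized eigenspace of the central element [casimir]. *)
Definition block s : set U :=
  [set x | exists n, (casimir - (beta s)%:A) ^+ n * x = 0]%classic.

Definition corner_idem s : U := idem false s + idem true (p - s).

Definition basic_algebra s : set U :=
  [set corner_idem s * x * corner_idem s | x in block s]%classic.

Definition Xp s : U :=
  (\prod_(1 <= l < p - s) (- (qint l * qint (p - s - l))))^-1
    *: (uE ^+ (p - s) * idem false s).
Definition Yp s : U := uF ^+ s * idem false s.
Definition Ap s : U := uF * uE * idem false s.

Definition Xm s : U :=
  (\prod_(1 <= l < s) (qint l * qint (s - l)))^-1
    *: (uE ^+ s * idem true (p - s)).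
Definition Ym s : U := uF ^+ (p - s) * idem true (p - s).
Definition Am s : U := uF * uE * idem true (p - s).

End Idempotents.

Arguments block {C p} q hp s _.
Arguments basic_algebra {C p} q hp s _.

Inductive bindex := I_ep | I_em | I_Xp | I_Xm | I_Yp | I_Ym | I_Ap | I_Am.

Definition bindex_seq := [:: I_ep; I_em; I_Xp; I_Xm; I_Yp; I_Ym; I_Ap; I_Am].

Definition bindex_code (i : bindex) : 'I_8 :=
  inord (match i with
         | I_ep => 0 | I_em => 1 | I_Xp => 2 | I_Xm => 3
         | I_Yp => 4 | I_Ym => 5 | I_Ap => 6 | I_Am => 7
         end).

Lemma bindex_codeK : cancel bindex_code (fun k => nth I_ep bindex_seq k).
Proof. by case; rewrite /bindex_code inordK. Qed.

HB.instance Definition _ := Finite.copy bindex (can_type bindex_codeK).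

Section BasicBasis.
Variables (C : fieldType) (p : nat) (q : C) (hp : (1 < p)%N) (s : nat).

Definition bvec (i : bindex) : Uq q hp :=
  match i with
  | I_ep => idem q hp false s
  | I_em => idem q hp true (p - s)
  | I_Xp => Xp q hp s
  | I_Xm => Xm q hp s
  | I_Yp => Yp q hp s
  | I_Ym => Ym q hp s
  | I_Ap => Ap q hp s
  | I_Am => Am q hp s
  end.

End BasicBasis.

(* [Some k]: the product is the basis vector k; [None]: the product is 0. *)
Definition btable (i j : bindex) : option bindex :=
  match i, j with
  | I_ep, I_ep => Some I_ep
  | I_em, I_em => Some I_em
  | I_ep, I_Ap | I_Ap, I_ep => Some I_Ap
  | I_em, I_Am | I_Am, I_em => Some I_Am
  | I_Xp, I_ep | I_em, I_Xp => Some I_Xp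
  | I_Yp, I_ep | I_em, I_Yp => Some I_Yp
  | I_Xm, I_em | I_ep, I_Xm => Some I_Xm
  | I_Ym, I_em | I_ep, I_Ym => Some I_Ym
  | I_Xp, I_Ym | I_Yp, I_Xm => Some I_Am
  | I_Xm, I_Yp | I_Ym, I_Xp => Some I_Ap
  | _, _ => None
  end.

Definition is_algebra_with_unit (C : fieldType) (U : algType C)
    (S : set U) (e : U) : Prop :=
  [/\ S e,
      forall x, S x -> e * x = x /\ x * e = x,
      forall a x y, S x -> S y -> S (a *: x + y) &
      forall x y, S x -> S y -> S (x * y)].

Definition is_basis (C : fieldType) (U : lmodType C) (S : set U)
    (I : finType) (v : I -> U) : Prop :=
  [/\ forall i, S (v i),
      forall c : I -> C, \sum_i c i *: v i = 0 -> forall i, c i = 0 &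
      forall x, S x -> exists c : I -> C, x = \sum_i c i *: v i].

Definition root_q (R : realType) (p : nat) : R[i] :=
  Complex (cos (pi / p%:R)) (sin (pi / p%:R)).

(* Main.v *)
From HB Require Import structures.
Require Import Defs.
From mathcomp Require Import all_boot all_order all_algebra.
From mathcomp Require Import all_classical all_reals all_analysis.
From mathcomp Require Import complex.
From mathcomp Require Import ring lra zify.

(** Let Y be the Casimir element minus beta_s.  On a vector w of K-weight
    l = +-q^(s-1) each product E^m F^m acts as the product of the Y + z_i for
    1 <= i <= m, where z_i = +-[i][s-i].  Write A for the product of the X + z_i
    with i < s, and D for the one with s < i < p; both are units at X = 0.  As
    z_s = z_p = 0, one gets a_0 = (X A D)(Y) v, a telescoping sum gives
    b_0 = (A D)(Y) v, and F^p = 0 gives (X^2 A D)(Y) v = 0.  The constants gamma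
    and delta are such that the idempotent is G(Y) w, with w = v / 2p the
    projection onto the weight l, G = 1 mod X^2 and G = 0 mod A D.  So Y^2 kills
    the idempotent, which fixes every vector of weight l killed by Y^2, and all
    the products in the table follow from the formulas for E^m F^m and F^m E^m.
    The left ideal generated by an idempotent e is spanned by the E^k P(Y) e and
    F^k P(Y) e, and comparing weights leaves only two of them in each corner.
    For independence it suffices that Y e, a multiple of a_0, is nonzero: in the
    module with basis E^a F^b w for a, b < p, the vector a_0 acts on w to give a
    multiple of the last basis vector. *)

Set Implicit Arguments.
Unset Strict Implicit.
Unset Printing Implicit Defensive.

Import Order.TTheory GRing.Theory Num.Theory.
Local Open Scope ring_scope.

(** * Modules over the restricted quantum group *)

Section Action.
Variables (C : fieldType) (p : nat) (q : C) (hp : (1 < p)%N).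
Variables (V : lmodType C) (e f k : {linear V -> V}).

(** The action is defined on expressions, so that it descends to the quotient once the three
    operators satisfy the relations. *)
Fixpoint act (x : qexpr C) (u : V) : V :=
  match x with
  | GenE => e u | GenF => f u | GenK => k u
  | Scal a => a *: u
  | Add x y => act x u + act y u
  | Mul x y => act x (act y u)
  end.

Lemma act_linear x a : {morph act x : u v / a *: u + v}.
Proof.
elim: x => [||| b | x IHx y IHy | x IHx y IHy] u v /=; rewrite ?linearP //.
- by rewrite IHx IHy scalerDr addrACA.
- by rewrite IHy IHx.
Qed.

Lemma act_pow x n u : act (Pow x n) u = iter n (act x) u.
Proof. by elim: n => [|n IHn] /=; rewrite ?scale1r ?IHn. Qed.

Hypotheses (ep : forall u, iter p e u = 0) (fp : forall u, iter p f u = 0).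
Hypothesis kp : forall u, iter (2 * p) k u = u.
Hypothesis ke : forall u, k (e u) = q ^+ 2 *: e (k u).
Hypothesis kf : forall u, k (f u) = q ^- 2 *: f (k u).
Hypothesis ef : forall u,
  e (f u) - f (e u) = (q - q^-1)^-1 *: (k u - iter (2 * p - 1) k u).

(** Induction on the congruence. The conjugation relations reduce to [ke] and [kf] because the power
    [2 * p - 1] of [k] inverts [k]. *)
Lemma act_ueq x y : ueq p q x y -> forall u, act x u = act y u.
Proof.
have kS u : k (iter (2 * p - 1) k u) = u.
  by rewrite -iterS subn1 prednK ?muln_gt0 ?(ltnW hp) // kp.
elim=> //=.
- by move=> {}y {}x z _ xy _ yz u; rewrite xy yz.
- by move=> {}x x' {}y y' _ xx' _ yy' u; rewrite xx' yy'.
- by move=> {}x x' {}y y' _ xx' _ yy' u; rewrite xx' yy'.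
- by move=> *; rewrite addrA.
- by move=> *; rewrite addrC.
- by move=> *; rewrite scale0r add0r.
- by move=> *; rewrite scaleN1r addNr scale0r.
- by move=> *; rewrite scale1r.
- by move=> *; rewrite scale1r.
- by move=> {}x {}y z u; have := act_linear x 1 (act y u) (act z u); rewrite !scale1r.
- by move=> *; rewrite scalerDl.
- by move=> *; rewrite scalerA.
(* Homogeneity is [act_linear] with second vector 0, once [act x 0 = 0] is known; the coefficient -1
   at two zero vectors gives the latter. *)
- move=> a {}x u; have /= x0 := act_linear x (-1) 0 0.
  move: (act_linear x a u 0); rewrite addr0 => ->.
  by rewrite scaler0 addr0 scaleN1r addNr in x0; rewrite x0 addr0.
- by move=> u; rewrite act_pow scale0r.
- by move=> u; rewrite act_pow scale0r.
- by move=> u; rewrite act_pow scale1r.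
- by move=> u; rewrite act_pow ke kS.
- by move=> u; rewrite act_pow kf kS.
- by move=> u; rewrite act_pow !scaleN1r.
Qed.

Definition uact (x : Uq q hp) : V -> V := act (urepr x).

Lemma uact_class x u : uact (uclass q hp x) u = act x u.
Proof. exact/act_ueq/urepr_class. Qed.

Lemma uactD x y u : uact (x + y) u = uact x u + uact y u.
Proof. by rewrite -(ureprK x) -(ureprK y) -uclass_add !uact_class. Qed.

Lemma uactM x y u : uact (x * y) u = uact x (uact y u).
Proof. by rewrite -(ureprK x) -(ureprK y) -uclass_mul !uact_class. Qed.

Lemma uactZ a x u : uact (a *: x) u = a *: uact x u.
Proof. by rewrite -(ureprK x) -uclass_scale !uact_class. Qed.

Lemma uact_exp x n u : uact (x ^+ n) u = iter n (uact x) u.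
Proof.
elim: n => [|n IHn]; last by rewrite exprS uactM IHn.
by rewrite expr0 -[1 in LHS]scale1r -uclass_scal uact_class /= scale1r.
Qed.

Lemma uact0 u : uact 0 u = 0.
Proof. by rewrite -[0 in LHS](scale0r 1) uactZ scale0r. Qed.

Lemma uact_sum I (r : seq I) (P : pred I) F u :
  uact (\sum_(i <- r | P i) F i) u = \sum_(i <- r | P i) uact (F i) u.
Proof.
apply: (big_ind2 (fun x v => uact x u = v)) => // [|x _ y _ <- <-].
  exact: uact0.
exact: uactD.
Qed.

End Action.

(** * Roots of unity and q-integers *)

Section Roots.
Variables (C : fieldType) (p : nat) (q : C).
Hypotheses (hp : (1 < p)%N) (qP : (2 * p).-primitive_root q).

Lemma unity_neq0 (z : C) : z ^+ (2 * p) = 1 -> z != 0.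
Proof.
move=> z1; apply/eqP=> z0; have /eqP := z1.
by rewrite z0 expr0n muln_eq0 /= gtn_eqF ?(ltnW hp) // eq_sym oner_eq0.
Qed.

Lemma unity_inv (z : C) : z ^+ (2 * p) = 1 -> z ^+ (2 * p - 1) = z^-1.
Proof.
move=> z1; have z0 := unity_neq0 z1.
by apply: (mulfI z0); rewrite divff // -exprS subn1 prednK ?z1 // muln_gt0 (ltnW hp).
Qed.

Lemma qX2p : q ^+ (2 * p) = 1. Proof. exact: prim_expr_order. Qed.

Lemma q_neq0 : q != 0. Proof. exact/unity_neq0/qX2p. Qed.

Lemma qXX n : (q ^+ n) ^+ (2 * p) = 1.
Proof. by rewrite -exprM mulnC exprM qX2p expr1n. Qed.

Lemma qX_eq1 n : (q ^+ n == 1) = (2 * p %| n)%N.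
Proof. by rewrite (prim_order_dvd qP). Qed.

(** The square is 1, and the power itself is not 1 because 2p does not divide p. *)
Lemma qXp : q ^+ p = -1.
Proof.
have /eqP : (q ^+ p) ^+ 2 = 1 by rewrite -exprM mulnC qX2p.
rewrite sqrf_eq1 qX_eq1 => /orP[/dvdn_leq|/eqP //].
by move=> /(_ (ltnW hp)); rewrite leqNgt -[X in (X < _)%N]mul1n ltn_pmul2r // ltnW.
Qed.

Lemma q2X_eq n m : (q ^+ (2 * n) == q ^+ (2 * m)) = (n == m %[mod p])%N.
Proof. by rewrite (eq_prim_root_expr qP) -!muln_modr eqn_pmul2l. Qed.

Lemma qsubV_neq0 : q - q^-1 != 0.
Proof.
have q0 := q_neq0.
apply: contra_neq (_ : q ^+ 2 != 1) => [/subr0_eq qV|].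
  by rewrite expr2 {2}qV divff.
by rewrite qX_eq1 -[X in (_ %| X)%N]muln1 dvdn_pmul2l // dvdn1 gtn_eqF.
Qed.

Lemma qint_neq0 n : (0 < n < p)%N -> qint q n != 0.
Proof.
case/andP=> n0 np; have q0 := q_neq0.
rewrite /qint mulf_neq0 ?invr_eq0 ?qsubV_neq0 //.
apply: contra_neq (_ : q ^+ (2 * n) != 1) => [/subr0_eq qV|].
  by rewrite mulnC exprM expr2 {2}qV divff // expf_neq0.
by rewrite qX_eq1 dvdn_pmul2l // gtnNdvd.
Qed.

Lemma natr2p_neq0 : (2 * p)%:R != 0 :> C.
Proof. exact: prim_root_natf_neq0 qP. Qed.

Lemma sum_root_of_unity n (z : C) :
  z ^+ n = 1 -> z != 1 -> \sum_(i < n) z ^+ i = 0.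
Proof.
move=> zn z1; apply/eqP.
have /eqP := subrX1 z n; rewrite zn subrr eq_sym mulf_eq0 subr_eq0.
by rewrite (negPf z1).
Qed.

(** The scalar by which E F - F E acts on vectors of K-weight [m]. *)
Definition kappa (m : C) := (q - q^-1)^-1 * (m - m^-1).

(** Both halves of [kappa] give geometric sums of a nontrivial p-th root of unity, [q ^+ 2] or its
    inverse. This makes the truncations E^p = 0 and F^p = 0 compatible with the commutator of E and
    F. *)
Lemma sum_kappa m :
  (\sum_(i < p) kappa (q ^+ (2 * i) * m) = 0) *
  (\sum_(i < p) kappa (q ^- (2 * i) * m) = 0).
Proof.
have q0 := q_neq0; have q21 : q ^+ 2 != 1.
  by rewrite qX_eq1 -[X in (_ %| X)%N]muln1 dvdn_pmul2l // dvdn1 gtn_eqF.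
have q2p : (q ^+ 2) ^+ p = 1 by rewrite -exprM qX2p.
have sE := sum_root_of_unity q2p q21.
have sV : \sum_(i < p) ((q ^+ 2)^-1) ^+ i = 0.
  apply: sum_root_of_unity; first by rewrite exprVn q2p invr1.
  by rewrite invr_eq1.
split; rewrite -mulr_sumr sumrB.
  under eq_bigr do rewrite exprM.
  under [X in _ * (_ - X)]eq_bigr do rewrite invfM exprM -exprVn.
  by rewrite -!mulr_suml sE sV !mul0r subrr mulr0.
under eq_bigr do rewrite exprM -exprVn.
under [X in _ * (_ - X)]eq_bigr do rewrite exprM -exprVn invfM exprVn invrK.
by rewrite -!mulr_suml sE sV !mul0r subrr mulr0.
Qed.

End Roots.

(** * The module of dimension p^2 generated by a vector of given weight *)

Section WeightModule.
Variables (C : fieldType) (p : nat) (q : C).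
Hypotheses (hp : (1 < p)%N) (qP : (2 * p).-primitive_root q).
Variable l : C.
Hypothesis lX : l ^+ (2 * p) = 1.

Local Notation V := 'M[C]_p.
Local Notation kap := (kappa q).

(* The vector E^a F^b w, for w of weight l. *)
Definition mono (a b : nat) : V :=
  \matrix_(i < p, j < p) ((i == a :> nat) && (j == b :> nat))%:R.

Lemma mono_out a b : ((p <= a) || (p <= b))%N -> mono a b = 0.
Proof.
move=> ab; apply/matrixP=> i j; rewrite !mxE.
case: eqP => //= ia; case: eqP => //= jb.
by move: ab; rewrite -ia -jb leqNgt ltn_ord leqNgt ltn_ord.
Qed.

Lemma mono_neq0 a b : (a < p)%N -> (b < p)%N -> mono a b != 0.
Proof.
move=> ap bp; apply/eqP => /matrixP /(_ (Ordinal ap) (Ordinal bp)) /eqP.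
by rewrite !mxE !eqxx oner_eq0.
Qed.

Section Extend.
Variable phi : nat -> nat -> V.

Definition mext (u : V) : V := \sum_i \sum_j u i j *: phi i j.

Lemma mext_linear : linear mext.
Proof.
move=> a u v; rewrite /mext scaler_sumr -big_split; apply: eq_bigr => i _ /=.
rewrite scaler_sumr -big_split; apply: eq_bigr => j _ /=.
by rewrite !mxE scalerDl scalerA.
Qed.

HB.instance Definition _ := GRing.isLinear.Build C V V *:%R mext mext_linear.

Lemma mextE a b : (a < p)%N -> (b < p)%N -> mext (mono a b) = phi a b.
Proof.
move=> ap bp; rewrite /mext (bigD1 (Ordinal ap)) //= [X in _ + X]big1.
  rewrite (bigD1 (Ordinal bp)) //= [X in _ + X + _]big1 => [|j jb].
    by rewrite mxE !eqxx scale1r !addr0.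
  by rewrite !mxE /= -val_eqE /= in jb *; rewrite (negPf jb) andbF scale0r.
move=> i ia; rewrite big1 // => j _.
by rewrite !mxE /= -val_eqE /= in ia *; rewrite (negPf ia) scale0r.
Qed.

End Extend.

Lemma mono_ind (P : V -> Prop) :
    P 0 -> (forall a u v, P u -> P v -> P (a *: u + v)) ->
    (forall a b, (a < p)%N -> (b < p)%N -> P (mono a b)) ->
  forall u, P u.
Proof.
move=> P0 PD Pm u; have -> : u = \sum_(i < p) \sum_(j < p) u i j *: mono i j.
  apply/matrixP=> i j; rewrite summxE (bigD1 i) //= summxE (bigD1 j) //=.
  rewrite !mxE !eqxx mulr1 !big1 ?addr0 // => [k ki|k kj].
    rewrite summxE big1 // => m _; rewrite !mxE eq_sym val_eqE (negPf ki) /=.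
    by rewrite mulr0.
  by rewrite !mxE eqxx /= eq_sym val_eqE (negPf kj) mulr0.
have PD1 v w : P v -> P w -> P (v + w).
  by move=> Pv Pw; rewrite -[v]scale1r; apply: PD.
apply: big_ind => // i _; apply: big_ind => // j _.
by rewrite -[_ *: _]addr0; apply: PD => //; apply: Pm.
Qed.

Lemma iter_linear n (f : {linear V -> V}) : linear (iter n f).
Proof. by move=> a u v; elim: n => // n /= ->; rewrite linearP. Qed.

Lemma iter_linear0 n (f : {linear V -> V}) : iter n f 0 = 0.
Proof. by elim: n => // n /= ->; rewrite raddf0. Qed.

Definition mwt a b := q ^+ (2 * a) * (q ^- (2 * b) * l).
(** The coefficient of E^(a-1) F^b w that appears when F is moved to the right through E^a in F E^a
    F^b w. *)
Definition mcoef a b := \sum_(i < a) kap (q ^+ (2 * i) * (q ^- (2 * b) * l)).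

Definition opE : {linear V -> V} := mext (fun a b => mono a.+1 b).
Definition opK : {linear V -> V} := mext (fun a b => mwt a b *: mono a b).
Definition opF : {linear V -> V} :=
  mext (fun a b => mono a b.+1 - mcoef a b *: mono a.-1 b).

Lemma opE_mono a b : opE (mono a b) = mono a.+1 b.
Proof.
case: (ltnP a p) => ap; last first.
  by rewrite !mono_out ?raddf0 ?leqW ?ap.
case: (ltnP b p) => bp; last by rewrite !mono_out ?raddf0 ?bp ?orbT.
exact: mextE.
Qed.

Lemma opK_mono a b : opK (mono a b) = mwt a b *: mono a b.
Proof.
case: (ltnP a p) => ap; last by rewrite !mono_out ?raddf0 ?scaler0 ?ap.
case: (ltnP b p) => bp; last by rewrite !mono_out ?raddf0 ?scaler0 ?bp ?orbT.
exact: mextE.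
Qed.

Lemma opF_mono a b : (a <= p)%N ->
  opF (mono a b) = mono a b.+1 - mcoef a b *: mono a.-1 b.
Proof.
rewrite leq_eqVlt => /orP[/eqP ->|ap].
  (* At a = p the vector [mono a.-1 b] need not vanish, but its coefficient is a full sum of
     [kappa]. *)
  rewrite !(@mono_out p) ?leqnn // raddf0 /mcoef.
  by rewrite (sum_kappa hp qP) scale0r subrr.
case: (ltnP b p) => bp; first exact: mextE.
have out c : (p <= c)%N -> forall a', mono a' c = 0.
  by move=> pc a'; rewrite mono_out ?pc ?orbT.
by rewrite !out ?leqW // raddf0 scaler0 subr0.
Qed.

Lemma opE_iter n a b : iter n opE (mono a b) = mono (n + a) b.
Proof. by elim: n => // n IHn; rewrite iterS IHn opE_mono. Qed.

Lemma opK_iter n a b : iter n opK (mono a b) = mwt a b ^+ n *: mono a b.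
Proof.
elim: n => [|n IHn]; first by rewrite scale1r.
by rewrite iterS IHn linearZ /= opK_mono scalerA exprSr.
Qed.

Lemma opF_iter0 n b : iter n opF (mono 0 b) = mono 0 (n + b).
Proof.
by elim: n => // n IHn; rewrite iterS IHn opF_mono // /mcoef big_ord0 scale0r subr0.
Qed.

Lemma mwtX a b : mwt a b ^+ (2 * p) = 1.
Proof.
by rewrite /mwt !exprMn exprVn lX mulr1 !(qXX qP) invr1 mulr1.
Qed.

Lemma op_KE u : opK (opE u) = q ^+ 2 *: opE (opK u).
Proof.
elim/mono_ind: u => [|a u v IHu IHv|a b _ _].
- by rewrite !raddf0.
- by rewrite !linearP /= IHu IHv.
rewrite opE_mono !opK_mono linearZ /= opE_mono scalerA; congr (_ *: _).
by rewrite /mwt mulnS exprD !mulrA.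
Qed.

Lemma op_KF u : opK (opF u) = q ^- 2 *: opF (opK u).
Proof.
have q0 := q_neq0 hp qP.
elim/mono_ind: u => [|a u v IHu IHv|a b ap _].
- by rewrite !raddf0.
- by rewrite !linearP /= IHu IHv.
rewrite opF_mono 1?ltnW // raddfB /= (linearZZ opK) !opK_mono.
rewrite (linearZZ opF) /=.
rewrite opF_mono 1?ltnW // !scalerBr !scalerA; congr (_ *: _ - _).
  rewrite /mwt mulnS exprD; field.
  by rewrite ?expf_neq0.
case: a ap => [|a] _; first by rewrite /mcoef big_ord0 mulr0 !mul0r !scale0r.
congr (_ *: _); rewrite /mwt mulnS exprD; field.
by rewrite ?expf_neq0.
Qed.

Lemma op_EF u :
  opE (opF u) - opF (opE u) =
    (q - q^-1)^-1 *: (opK u - iter (2 * p - 1) opK u).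
Proof.
elim/mono_ind: u => [|a u v IHu IHv|a b ap bp].
- rewrite iter_linear0 (raddf0 opF) (raddf0 opE) (raddf0 opF) (raddf0 opK).
  by rewrite subrr scaler0.
- have lin x y x' y' : a *: x + y - (a *: x' + y') = a *: (x - x') + (y - y').
    by move=> *; rewrite opprD addrACA scalerBr.
  rewrite (linearP opF) (linearP opE) (linearP opE) (linearP opF) (linearP opK).
  by rewrite iter_linear !lin IHu IHv [in RHS]scalerDr !scalerA mulrC.
rewrite opE_mono opF_mono 1?ltnW // opF_mono // (linearB opE) (linearZZ opE).
rewrite /= opE_mono.
(* At a = 0 the default value [0.-1 = 0] does no harm, since [mcoef 0 b] is an empty sum. *)
have -> : mcoef a b *: opE (mono a.-1 b) = mcoef a b *: mono a b.
  case: a {ap} => [|a]; last by rewrite opE_mono.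
  by rewrite /mcoef big_ord0 !scale0r.
rewrite opprB addrC addrA subrK -scalerBl opK_mono opK_iter -scalerBl scalerA.
congr (_ *: _).
by rewrite (unity_inv hp (mwtX a b)) /mcoef big_ord_recr [LHS]addrC addKr.
Qed.

Lemma op_EF_weight m u : opK u = m *: u -> m ^+ (2 * p) = 1 ->
  opF (opE u) = opE (opF u) - kap m *: u.
Proof.
move=> Ku mX; have Kn n : iter n opK u = m ^+ n *: u.
  elim: n => [|n IHn]; first by rewrite scale1r.
  by rewrite iterS IHn linearZ /= Ku scalerA exprSr.
have <- : opE (opF u) - opF (opE u) = kap m *: u.
  rewrite op_EF Ku Kn -scalerBl scalerA; congr (_ * (_ - _) *: _).
  exact: unity_inv mX.
by rewrite opprB addrC subrK.
Qed.

(** One E is moved through F^n, and each commutator contributes [kappa] of the weight met there. At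
    n = 0 the sum is empty, so the default [0.-1] is harmless. *)
Lemma opF_iterS n a b : (a.+1 < p)%N ->
  iter n opF (mono a.+1 b) =
  opE (iter n opF (mono a b)) -
    (\sum_(i < n) kap (q ^- (2 * i) * mwt a b)) *: iter n.-1 opF (mono a b).
Proof.
move=> ap; elim: n => [|n IHn]; first by rewrite big_ord0 scale0r subr0 opE_mono.
have Kn : opK (iter n opF (mono a b)) =
    (q ^- (2 * n) * mwt a b) *: iter n opF (mono a b).
  elim: n {IHn} => [|n IHn]; first by rewrite /= opK_mono invr1 mul1r.
  rewrite iterS op_KF IHn (linearZZ opF) scalerA mulnS exprD.
  by rewrite (invfM (q ^+ 2)) mulrA.
have mX : (q ^- (2 * n) * mwt a b) ^+ (2 * p) = 1.
  by rewrite exprMn mwtX mulr1 exprVn (qXX qP) invr1.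
rewrite iterS IHn (linearB opF) (op_EF_weight Kn mX) (linearZZ opF) big_ord_recr.
rewrite [in RHS]scalerDl [in RHS]opprD [in RHS]addrA [in RHS]addrAC.
congr (_ - _ - _).
by case: (n) => [|m]; rewrite ?big_ord0 ?scale0r.
Qed.

Lemma opE_nil u : iter p opE u = 0.
Proof.
elim/mono_ind: u => [|a u v IHu IHv|a b _ _]; first exact: iter_linear0.
  by rewrite iter_linear IHu IHv scaler0 addr0.
by rewrite opE_iter mono_out // leq_addr.
Qed.

(** Induction on the exponent of E: for n = p the correction term of [opF_iterS] has a full sum of
    [kappa] as coefficient. *)
Lemma opF_nil u : iter p opF u = 0.
Proof.
elim/mono_ind: u => [|a u v IHu IHv|a b ap _].
- exact: iter_linear0.
- by rewrite iter_linear IHu IHv scaler0 addr0.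
elim: a ap => [|a IHa] ap; first by rewrite opF_iter0 mono_out // leq_addr orbT.
rewrite opF_iterS // IHa 1?ltnW // [opE 0]raddf0 (sum_kappa hp qP).
by rewrite scale0r subr0.
Qed.

Lemma opK_unip u : iter (2 * p) opK u = u.
Proof.
elim/mono_ind: u => [|a u v IHu IHv|a b _ _].
- exact: iter_linear0.
- by rewrite iter_linear IHu IHv.
by rewrite opK_iter mwtX scale1r.
Qed.

(* E^(p-1) F^(p-1) w is a basis vector of the induced module. *)
Lemma weight_EF_neq0 :
  uE ^+ (p - 1) * uF ^+ (p - 1) *
    (\sum_(0 <= i < 2 * p) l^-1 ^+ i *: uK ^+ i) != 0 :> Uq q hp.
Proof.
have l0 := unity_neq0 hp lX.
apply/eqP => eq0.
have hM := @uactM _ _ _ hp _ _ _ _ opE_nil opF_nil opK_unip op_KE op_KF op_EF.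
have hX := @uact_exp _ _ _ hp _ _ _ _ opE_nil opF_nil opK_unip op_KE op_KF op_EF.
have hC := @uact_class _ _ _ hp _ _ _ _ opE_nil opF_nil opK_unip op_KE op_KF op_EF.
have hS := @uact_sum _ _ _ hp _ _ _ _ opE_nil opF_nil opK_unip op_KE op_KF op_EF.
have hZ := @uactZ _ _ _ hp _ _ _ _ opE_nil opF_nil opK_unip op_KE op_KF op_EF.
have h0 := @uact0 _ _ _ hp _ _ _ _ opE_nil opF_nil opK_unip op_KE op_KF op_EF.
move: (h0 (mono 0 0)); rewrite -eq0 !hM hS.
(* Each summand fixes [mono 0 0], which has weight [l], so the whole sum multiplies it by 2p. *)
under eq_bigr => i _.
  rewrite hZ hX (eq_iter (hC GenK)) opK_iter /mwt muln0 expr0 invr1 !mul1r.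
  rewrite scalerA -exprMn mulVf // expr1n scale1r.
over.
rewrite big_const_nat subn0 iter_addr_0 !hX (eq_iter (hC GenF)) (eq_iter (hC GenE)) /=.
have iZ n (f : {linear V -> V}) a u : iter n f (a *: u) = a *: iter n f u.
  by elim: n => // n IHn; rewrite !iterS IHn linearZ.
rewrite -scaler_nat !iZ opF_iter0 opE_iter => /eqP.
rewrite scaler_eq0 (negPf (natr2p_neq0 qP)) /= !addn0.
by apply/negP/mono_neq0; rewrite subn1 prednK // ltnW.
Qed.

End WeightModule.

(** * Polynomials split into linear factors *)

Section Polynomials.
Variable C : fieldType.
Implicit Type c : nat -> C.

Definition linprod c n : {poly C} := \prod_(1 <= i < n) ('X + (c i)%:P).

Lemma linprodS c n : (0 < n)%N -> linprod c n.+1 = linprod c n * ('X + (c n)%:P).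
Proof. by move=> n0; rewrite /linprod big_nat_recr. Qed.

(** In the induction the new factor X + c_n is split: c_n multiplies the earlier terms, and X times
    the shorter product is the new term. Taken with [cD], this evaluates [b0]. *)
Lemma linprod_telescope c n : (0 < n)%N ->
  (\prod_(1 <= k < n) c k)%:P +
    \sum_(1 <= t < n) (\prod_(t.+1 <= k < n) c k)%:P * ('X * linprod c t) =
  linprod c n.
Proof.
case: n => // n _; elim: n => [|n IHn].
  by rewrite /linprod !big_geq // addr0.
rewrite linprodS // big_nat_recr //= [X in _ + X = _]big_nat_recr //=.
rewrite (@big_geq _ _ _ n.+2) // mul1r.
have -> : \sum_(1 <= t < n.+1) (\prod_(t.+1 <= k < n.+2) c k)%:P * ('X * linprod c t)
    = (\sum_(1 <= t < n.+1) (\prod_(t.+1 <= k < n.+1) c k)%:P * ('X * linprod c t))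
      * (c n.+1)%:P.
  rewrite mulr_suml; apply: eq_big_nat => t /andP[_ tn].
  by rewrite big_nat_recr //= rmorphM /= mulrAC.
by rewrite addrA rmorphM /= -mulrDl IHn mulrDr addrC ['X * _]mulrC.
Qed.

(** The first two coefficients have the shape of the products in [gamma] and of the sums in [delta].
    Only residues modulo X^2 matter, so the tail stays existential. *)
Lemma linprod_expand c n : exists R : {poly C},
  linprod c n = (\prod_(1 <= i < n) c i)%:P
    + (\sum_(1 <= j < n) \prod_(1 <= k < n | k != j) c k)%:P * 'X + R * 'X^2.
Proof.
case: n => [|n]; first by exists 0; rewrite /linprod !big_geq // polyC0 !mul0r !addr0.
elim: n => [|n [R IHn]]; first by
  exists 0; rewrite /linprod !big_geq // polyC0 !mul0r !addr0.
set a := \prod_(_ <= _ < _) _ in IHn; set b := \sum_(_ <= _ < _) _ in IHn.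
exists (b%:P + R * ('X + (c n.+1)%:P)).
rewrite linprodS // IHn big_nat_recr //= -/a [\sum_(_ <= _ < _) _]big_nat_recr //=.
have -> : \sum_(1 <= i < n.+1) \prod_(1 <= k < n.+2 | k != i) c k = b * c n.+1.
  rewrite mulr_suml; apply: eq_big_nat => i /andP[_ iN].
  by rewrite big_mkcond big_nat_recr //= gtn_eqF //= -big_mkcond.
have -> : \prod_(1 <= i < n.+2 | i != n.+1) c i = a.
  rewrite big_mkcond big_nat_recr //= eqxx mulr1 [RHS]big_nat.
  rewrite big_nat; apply: eq_bigr => i /andP[_ iN].
  by rewrite ltn_eqF.
by rewrite !rmorphM !rmorphD !rmorphM /=; ring.
Qed.

End Polynomials.

(** * The Casimir element on weight vectors *)

Section Weights.
Variables (C : fieldType) (p : nat) (q : C).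
Hypotheses (hp : (1 < p)%N) (qP : (2 * p).-primitive_root q).

Local Notation U := (Uq q hp).
Local Notation E := (@uE C p q hp).
Local Notation F := (@uF C p q hp).
Local Notation K := (@uK C p q hp).
Local Notation cas := (casimir q hp).
Implicit Types (l m t : C) (x y : U).

Lemma uKinvK : uKinv * K = 1.
Proof. by rewrite /uKinv -exprSr exprS uKKinv. Qed.

Lemma uKE : K * E = q ^+ 2 *: (E * K).
Proof.
have [_ [KE _ _]] := Uq_relations q hp.
by rewrite scalerAl -KE -!mulrA uKinvK mulr1.
Qed.

Lemma uKF : K * F = q ^- 2 *: (F * K).
Proof.
have [_ [_ KF _]] := Uq_relations q hp.
by rewrite scalerAl -KF -!mulrA uKinvK mulr1.
Qed.

Lemma uEF : E * F = F * E + (q - q^-1)^-1 *: (K - uKinv).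
Proof.
have [_ [_ _ EF]] := Uq_relations q hp.
by rewrite -EF addrC subrK.
Qed.

Definition weight l x := K * x = l *: x.

Lemma weightE l x : weight l x -> weight (q ^+ 2 * l) (E * x).
Proof. by move=> lx; rewrite /weight mulrA uKE -scalerAl -mulrA lx -scalerAr scalerA. Qed.

Lemma weightF l x : weight l x -> weight (q ^- 2 * l) (F * x).
Proof. by move=> lx; rewrite /weight mulrA uKF -scalerAl -mulrA lx -scalerAr scalerA. Qed.

Lemma weightE_exp n l x : weight l x -> weight (q ^+ (2 * n) * l) (E ^+ n * x).
Proof.
move=> lx; elim: n => [|n IHn]; first by rewrite !mul1r.
by rewrite exprS -mulrA mulnS exprD -mulrA; apply: weightE.
Qed.

Lemma weightF_exp n l x : weight l x -> weight (q ^- (2 * n) * l) (F ^+ n * x).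
Proof.
move=> lx; elim: n => [|n IHn]; first by rewrite invr1 !mul1r.
by rewrite exprS -mulrA mulnS exprD (invfM (q ^+ 2)) -mulrA; apply: weightF.
Qed.

Lemma weightZ l a x : weight l x -> weight l (a *: x).
Proof. by move=> lx; rewrite /weight -scalerAr lx !scalerA mulrC. Qed.

Lemma weight_Kinv l x : l != 0 -> weight l x -> uKinv * x = l^-1 *: x.
Proof.
move=> l0 lx; apply: (scalerI l0); rewrite scalerA divff // scale1r scalerAr.
by rewrite -lx mulrA uKinvK mul1r.
Qed.

Lemma qsq_neq1 : q * q - 1 != 0.
Proof.
have q0 := q_neq0 hp qP; have -> : q * q - 1 = (q - q^-1) * q by field.
by rewrite mulf_neq0 ?(qsubV_neq0 hp qP).
Qed.

(** On a vector of weight [l] the Casimir element exceeds E F by the value at [l / q] and F E by the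
    value at [q * l]. The eigenvalue beta_j is the value at q^j. *)
Definition casimir_val t := (t + t^-1) / (q - q^-1) ^+ 2.

Lemma weight_EF l x : l != 0 -> weight l x ->
  E * (F * x) = (cas - (casimir_val (l / q))%:A) * x.
Proof.
move=> l0 lx; have q0 := q_neq0 hp qP.
rewrite /casimir mulrBl mulrDl mulr_algl -[_ *: (_ + _) * x]scalerAl mulrDl.
rewrite -!scalerAl (weight_Kinv l0 lx) lx -mulrA -[RHS]addrA !scalerA -scalerDl.
rewrite scalerA -scalerBl; set c := (X in X *: x); suff -> : c = 0.
  by rewrite scale0r addr0.
by rewrite /c /casimir_val; field; rewrite q0 l0 qsq_neq1.
Qed.

Lemma weight_FE l x : l != 0 -> weight l x ->
  F * (E * x) = (cas - (casimir_val (q * l))%:A) * x.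
Proof.
move=> l0 lx; have q0 := q_neq0 hp qP.
have -> : F * (E * x) = E * (F * x) - (q - q^-1)^-1 *: ((K - uKinv) * x).
  by rewrite !mulrA uEF mulrDl -scalerAl addrK.
rewrite (weight_EF l0 lx) [(K - _) * x]mulrBl lx (weight_Kinv l0 lx) -scalerBl.
rewrite !mulrBl !mulr_algl.
rewrite -addrA -opprD scalerA -scalerDl; congr (_ - _ *: _).
by rewrite /casimir_val; field; rewrite q0 l0 qsq_neq1.
Qed.

Lemma casimirC x : cas * x = x * cas.
Proof.
have q0 := q_neq0 hp qP.
have KVE : uKinv * E = q ^- 2 *: (E * uKinv).
  rewrite -[E in LHS]mulr1 -(uKKinv q hp) -[K * _]/(K * uKinv) [E * (K * _)]mulrA.
  rewrite -[E * K]scale1r -(@mulVf _ (q ^+ 2)) ?expf_neq0 // -scalerA -uKE.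
  by rewrite -scalerAl -scalerAr !mulrA uKinvK mul1r.
have KVF : uKinv * F = q ^+ 2 *: (F * uKinv).
  rewrite -[F in LHS]mulr1 -(uKKinv q hp) -[K * _]/(K * uKinv) [F * (K * _)]mulrA.
  rewrite -[F * K]scale1r -(@mulfV _ (q ^+ 2)) ?expf_neq0 // -scalerA -uKF.
  by rewrite -scalerAl -scalerAr !mulrA uKinvK mul1r.
have KKV : K * uKinv = uKinv * K by rewrite uKinvK uKKinv.
(* With the Casimir element written once through E F and once through F E, both sides of commutation
   with E contain E F E, and those with F contain F E F. *)
have cas2 : cas = F * E + ((q - q^-1) ^+ 2)^-1 *: (q *: K + q^-1 *: uKinv).
  rewrite /casimir uEF -addrA; congr (_ + _).
  rewrite !scalerBr !scalerDr !scalerA addrACA -scalerDl -scaleNr -scalerDl.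
  by congr (_ *: _ + _ *: _); field; rewrite q0 qsq_neq1.
have cas1 : cas = E * F + ((q - q^-1) ^+ 2)^-1 *: (q^-1 *: K + q *: uKinv) by [].
move: ((q - q^-1) ^+ 2)^-1 cas1 cas2 => c cas1 cas2.
have qqV : q * q ^- 2 = q^-1 by field.
have qVq : q^-1 * q ^+ 2 = q by field.
elim/Uq_ind: x => [|||a|x y IHx IHy|x y IHx IHy].
- rewrite [in RHS]cas2 cas1 mulrDl mulrDr -scalerAl -scalerAr.
  rewrite mulrDl mulrDr -!scalerAl -!scalerAr uKE KVE !scalerA qqV qVq.
  by rewrite -[E * F * E]mulrA.
- rewrite [in LHS]cas2 cas1 mulrDl mulrDr -scalerAl -scalerAr.
  rewrite mulrDl mulrDr -!scalerAl -!scalerAr uKF KVF !scalerA qqV qVq.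
  by rewrite -[F * E * F]mulrA.
- rewrite cas1 mulrDl mulrDr -scalerAl -scalerAr mulrDl mulrDr.
  rewrite -!scalerAl -!scalerAr KKV mulrA uKE; congr (_ + _).
  rewrite -scalerAl -[E * K * F]mulrA uKF -scalerAr scalerA mulfV ?expf_neq0 //.
  by rewrite scale1r mulrA.
- by rewrite mulr_algl mulr_algr.
- by rewrite [LHS]mulrDr IHx IHy [RHS]mulrDl.
- by rewrite mulrA IHx -mulrA IHy mulrA.
Qed.
(** X stands for the Casimir element minus a scalar, so that identities in the algebra become
    identities of polynomials. *)
Definition cas_eval t : {poly C} -> U := horner_alg (cas - (casimir_val t)%:A).

HB.instance Definition _ t := GRing.RMorphism.on (cas_eval t).

Lemma cas_evalZ t a P : cas_eval t (a *: P) = a *: cas_eval t P.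
Proof. by rewrite -mul_polyC rmorphM /= [cas_eval t _]horner_algC mulr_algl. Qed.

Lemma cas_evalC t P x : cas_eval t P * x = x * cas_eval t P.
Proof.
elim/poly_ind: P => [|P c IHP]; first by rewrite rmorph0 mul0r mulr0.
have phiX : cas_eval t 'X * x = x * cas_eval t 'X.
  rewrite /cas_eval horner_algX [LHS]mulrBl [RHS]mulrBr casimirC; congr (_ - _).
  by rewrite mulr_algl mulr_algr.
rewrite rmorphD rmorphM /= [LHS]mulrDl [RHS]mulrDr; congr (_ + _).
  by rewrite -[LHS]mulrA phiX mulrA IHP -mulrA.
by rewrite /cas_eval horner_algC mulr_algl mulr_algr.
Qed.

Lemma weight_cas_eval l t P x : weight l x -> weight l (cas_eval t P * x).
Proof. by move=> lx; rewrite /weight mulrA -cas_evalC -[LHS]mulrA lx scalerAr. Qed.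

Lemma cas_eval_shift t u x :
  (cas - (casimir_val u)%:A) * x =
    cas_eval t ('X + (casimir_val t - casimir_val u)%:P) * x.
Proof.
congr (_ * _); rewrite rmorphD /= /cas_eval horner_algX horner_algC scalerBl.
by rewrite addrA subrK.
Qed.

(** The innermost E F acts on F^n x, again a weight vector, as a linear factor in the Casimir
    element, which is central and can be pulled out. [linprod] starts at index 1, hence [n.+1] for n
    factors. *)
Lemma weight_EF_exp n l x : l != 0 -> weight l x ->
  E ^+ n * (F ^+ n * x) =
  cas_eval (q * l) (linprod (fun i =>
    casimir_val (q * l) - casimir_val (q * l / q ^+ (2 * i))) n.+1) * x.
Proof.
have q0 := q_neq0 hp qP.
move=> l0 lx; elim: n => [|n IHn].
  by rewrite /linprod big_geq // rmorph1 !mul1r.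
rewrite exprSr [F ^+ n.+1]exprS -[F * _ * x]mulrA -[LHS]mulrA.
rewrite (weight_EF _ (weightF_exp n lx)) ?mulf_neq0 ?invr_eq0 ?expf_neq0 //.
rewrite (cas_eval_shift (q * l)) mulrA -cas_evalC -[LHS]mulrA IHn.
rewrite [linprod _ n.+2]linprodS // rmorphM /=.
rewrite !mulrA -[X in _ = X * _]cas_evalC.
have -> : q ^- (2 * n) * l / q = q * l / q ^+ (2 * n.+1); last by [].
by rewrite mulnS exprD; field; rewrite q0 expf_neq0.
Qed.

(** The same argument with E and F exchanged. The product starts at i = 0, where the factor is X
    itself. *)
Lemma weight_FE_exp n l x : l != 0 -> weight l x ->
  F ^+ n * (E ^+ n * x) =
  cas_eval (q * l) (\prod_(0 <= i < n)
    ('X + (casimir_val (q * l) - casimir_val (q * l * q ^+ (2 * i)))%:P)) * x.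
Proof.
have q0 := q_neq0 hp qP.
move=> l0 lx; elim: n => [|n IHn].
  by rewrite big_geq // rmorph1 !mul1r.
rewrite exprSr [E ^+ n.+1]exprS -[E * _ * x]mulrA -[LHS]mulrA.
rewrite (weight_FE _ (weightE_exp n lx)) ?mulf_neq0 ?expf_neq0 //.
rewrite (cas_eval_shift (q * l)) mulrA -cas_evalC -[LHS]mulrA IHn big_nat_recr // rmorphM /=.
rewrite !mulrA -[X in _ = X * _]cas_evalC.
by rewrite [q * q ^+ _ * l]mulrAC.
Qed.

(** For a 2p-th root of unity [l], this is 2p times the projection onto the weight [l]. *)
Definition wsum l : U := \sum_(0 <= i < 2 * p) l^-1 ^+ i *: K ^+ i.

(** The sum is the cofactor of l^-1 K - 1 in (l^-1 K)^(2p) - 1, which is zero. *)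
Lemma weight_wsum l : l ^+ (2 * p) = 1 -> weight l (wsum l).
Proof.
move=> lX; have l0 := unity_neq0 hp lX.
have := subrX1 (l^-1 *: K) (2 * p).
have [[_ _ K1] _] := Uq_relations q hp.
rewrite exprZn K1 exprVn lX invr1 scale1r subrr [RHS]mulrBl mul1r.
under eq_bigr do rewrite exprZn.
rewrite -(big_mkord xpredT (fun i => l^-1 ^+ i *: K ^+ i)) => /esym/subr0_eq.
rewrite -scalerAl => /(congr1 (fun x => l *: x)).
by rewrite scalerA divff // scale1r.
Qed.

Lemma wsum_weight l m x : weight m x ->
  wsum l * x = (\sum_(i < 2 * p) (m / l) ^+ i) *: x.
Proof.
move=> mx; rewrite /wsum mulr_suml big_mkord scaler_suml; apply: eq_bigr => i _.
have Kx n : K ^+ n * x = m ^+ n *: x.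
  elim: n => [|n IHn]; first by rewrite mul1r scale1r.
  by rewrite exprSr -[LHS]mulrA mx -scalerAr IHn scalerA -exprS.
by rewrite -scalerAl Kx scalerA -exprMn mulrC.
Qed.

End Weights.

(** * The primitive idempotents *)

Section Idempotent.
Variables (C : fieldType) (p : nat) (q : C).
Hypotheses (hp : (1 < p)%N) (qP : (2 * p).-primitive_root q).
Variables (b : bool) (s : nat).
Hypothesis hs : (0 < s < p)%N.

Local Notation U := (Uq q hp).
Local Notation E := (@uE C p q hp).
Local Notation F := (@uF C p q hp).
Local Notation K := (@uK C p q hp).
Local Notation bt := (casimir_val q).
Local Notation e := (idem q hp b s).

(* F E acts on vectors of weight l as C - casimir_val (q l), and tlam = q lam. *)
Definition lam : C := (-1) ^+ b * q ^+ (s - 1).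
Definition tlam : C := (-1) ^+ b * q ^+ s.
Local Notation phi := (cas_eval q hp tlam).
(** [cA i] and [cD i] are the constants z_i and z_(s+i), on the two sides of z_s = 0. *)
Definition cA i : C := (-1) ^+ b * (qint q i * qint q (s - i)).
Definition cD i : C := - (-1) ^+ b * (qint q i * qint q (p - s - i)).

Lemma q_lam : q * lam = tlam.
Proof. by rewrite /lam mulrCA -exprS subn1 prednK //; case/andP: hs. Qed.

Lemma lamX : lam ^+ (2 * p) = 1.
Proof. by rewrite /lam exprMn (qXX qP) mulr1 exprM sqrr_sign expr1n. Qed.

Lemma lam_neq0 : lam != 0.
Proof. exact: (unity_neq0 hp lamX). Qed.

Lemma qint0 : qint q 0 = 0.
Proof. by rewrite /qint expr0 invr1 subrr mul0r. Qed.

Lemma sgnV : ((-1) ^+ b : C)^-1 = (-1) ^+ b.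
Proof. by rewrite -exprVn invrN1. Qed.

Lemma bt_lo i : (i <= s)%N -> bt tlam - bt (tlam / q ^+ (2 * i)) = cA i.
Proof.
move=> is_; have q0 := q_neq0 hp qP.
have Es : q ^+ s = q ^+ i * q ^+ (s - i) by rewrite -exprD subnKC.
rewrite /cA /qint /casimir_val /tlam Es !invfM invrK !sgnV mulnC exprM.
move: (expf_neq0 i q0) (expf_neq0 (s - i) q0) (qsq_neq1 hp qP).
move: (q ^+ i) (q ^+ (s - i)) => x y x0 y0 qq.
by field; rewrite q0 x0 y0 qq.
Qed.

Lemma bt_neg t : bt t^-1 = bt t.
Proof. by rewrite /casimir_val invrK addrC. Qed.

(** [q ^+ p = -1] expresses q^s through q^i and q^(p-s-i); what remains is an identity of rational
    functions. *)
Lemma bt_up i : (i <= p - s)%N -> bt tlam - bt (tlam * q ^+ (2 * i)) = cD i.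
Proof.
move=> is_; have q0 := q_neq0 hp qP.
have Es : q ^+ s = - (q ^+ i * q ^+ (p - s - i))^-1.
  rewrite -exprD subnKC //; apply: (mulIf (expf_neq0 (p - s) q0)).
  rewrite -exprD subnKC; last by case/andP: hs => _ /ltnW.
  by rewrite (qXp hp qP) mulNr mulVf // expf_neq0.
rewrite /cD /qint /casimir_val /tlam Es !invfM !sgnV mulnC exprM.
move: (expf_neq0 i q0) (expf_neq0 (p - s - i) q0) (qsq_neq1 hp qP).
move: (q ^+ i) (q ^+ (p - s - i)) => x y x0 y0 qq.
by field; rewrite q0 x0 y0 qq oppr_eq0 oner_eq0.
Qed.

(** This is [bt_up] after the symmetry t -> 1/t of the Casimir value, as the square of [tlam] is
    q^(2s). *)
Lemma bt_hi i : (i <= p - s)%N ->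
  bt tlam - bt (tlam / q ^+ (2 * (s + i))) = cD i.
Proof.
move=> is_; rewrite -bt_up //; congr (_ - _); rewrite -[LHS]bt_neg.
have q0 := q_neq0 hp qP.
congr (bt _); rewrite /tlam !invfM sgnV invrK mulnDr exprD.
rewrite [(2 * s)%N]mulnC exprM; field.
by rewrite expf_neq0.
Qed.

Local Notation zl := (fun i => bt tlam - bt (tlam / q ^+ (2 * i))).

Lemma linprod_lo : linprod zl s = linprod cA s.
Proof. by apply: eq_big_nat => i /andP[_ /ltnW is_]; rewrite bt_lo. Qed.

(** The factor at i = s has constant term [cA s = 0] and is the isolated X. *)
Lemma linprod_hi t : (0 < t <= (p - s).+1)%N ->
  linprod zl (s + t) = linprod cA s * 'X * linprod cD t.
Proof.
have s0 : (0 < s)%N by case/andP: hs.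
case: t => // t /= tp; rewrite /linprod (big_cat_nat _ (n := s)) ?leq_addr //=.
rewrite -[X in X * _]/(linprod zl s) linprod_lo -mulrA; congr (_ * _).
rewrite big_ltn; last by rewrite addnS ltnS leq_addr.
rewrite (bt_lo (leqnn s)) /cA subnn qint0 !mulr0 addr0; congr (_ * _).
rewrite -[in LHS]add1n big_addn addnS subSn ?leq_addr // addKn.
apply: eq_big_nat => i /andP[_ it]; rewrite addnC bt_hi //.
lia.
Qed.

Lemma vsumE : vsum q hp b s = wsum q hp lam.
Proof.
apply: eq_bigr => i _; congr (_ ^+ _ *: _).
by rewrite /lam invfM sgnV.
Qed.

Local Notation v := (wsum q hp lam).
Local Notation AD := (linprod cA s * linprod cD (p - s)).

Lemma v_weight : weight lam v.
Proof. exact: (weight_wsum q hp lamX). Qed.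

Lemma uEF_v n x : weight lam x ->
  E ^+ n * F ^+ n * x = phi (linprod zl n.+1) * x.
Proof. by move=> lx; rewrite -mulrA (weight_EF_exp qP n lam_neq0 lx) q_lam. Qed.

Lemma a0E : a0 q hp b s = phi ('X * AD) * v.
Proof.
have [s0 sp] := andP hs.
rewrite /a0 vsumE uEF_v; last exact: v_weight.
have -> : (p - 1).+1 = (s + (p - s))%N by lia.
by rewrite linprod_hi ?subn_gt0 ?sp ?leqnSn // [_ * 'X]mulrC mulrA.
Qed.

(** E^p F^p x vanishes, and its polynomial runs over i = 1, ..., p, where the factors at i = s and i
    = p both equal X. *)
Lemma nil2_AD x : weight lam x -> phi ('X^2 * AD) * x = 0.
Proof.
move=> lx; have [s0 sp] := andP hs; have [[_ Fp _] _] := Uq_relations q hp.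
have := uEF_v p lx; rewrite Fp mulr0 mul0r.
have -> : p.+1 = (s + (p - s).+1)%N by lia.
rewrite linprod_hi ?leqnn // linprodS ?subn_gt0 // /cD subnn qint0 !mulr0 addr0 => ->.
by congr (phi _ * _); ring.
Qed.

Lemma b0E : b0 q hp b s = phi AD * v.
Proof.
have [s0 sp] := andP hs.
rewrite -(@linprod_telescope _ cD) ?subn_gt0 // mulrDr rmorphD mulrDl /=.
rewrite [linprod cA s * \sum_(_ <= _ < _) _]mulr_sumr raddf_sum mulr_suml /=.
(* Reversing and shifting replace n by p - s - t. The term t = 0, with E^(s-1) F^(s-1), is the
   constant part of the telescope, and [alpha] becomes a tail product of the [cD]. *)
rewrite /b0 big_nat_rev /= add1n vsumE.
rewrite big_ltn ?ltnS ?subn_gt0 // big_add1 /=.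
have alphaE t : (t < p - s)%N ->
    alpha p q b s ((p - s).+2 - t.+2) = \prod_(t.+1 <= k < p - s) cD k.
  move=> tp; rewrite /alpha; congr (\big[_/_]_(i <- index_iota _ _) _); lia.
congr (_ + _).
  rewrite alphaE ?subn_gt0 // uEF_v; last exact: v_weight.
  have -> : (p - 1 - ((p - s).+2 - 2)).+1 = s by lia.
  by rewrite linprod_lo [_ * _%:P]mulrC mul_polyC cas_evalZ scalerAl.
apply: eq_big_nat => t /andP[t0 tp].
rewrite alphaE // uEF_v; last exact: v_weight.
have -> : (p - 1 - ((p - s).+2 - t.+2)).+1 = (s + t)%N by lia.
rewrite linprod_hi; last by rewrite t0 leqW // ltnW.
rewrite scalerAl -cas_evalZ -mul_polyC; congr (phi _ * _).
ring.
Qed.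

Lemma cA_neq0 i : (0 < i < s)%N -> cA i != 0.
Proof.
case/andP=> i0 is_; have sp : (s < p)%N by case/andP: hs.
rewrite /cA mulf_neq0 ?signr_eq0 // mulf_neq0 ?(qint_neq0 hp qP) //.
  by rewrite i0 (ltn_trans is_).
by rewrite subn_gt0 is_ (leq_ltn_trans (leq_subr _ _)).
Qed.

Lemma cD_neq0 i : (0 < i < p - s)%N -> cD i != 0.
Proof.
case/andP=> i0 is_; rewrite /cD mulf_neq0 ?oppr_eq0 ?signr_eq0 //.
have ip : (i < p)%N by apply: leq_trans is_ (leq_subr _ _).
have ? : (0 < p - s - i < p)%N by lia.
by rewrite mulf_neq0 ?(qint_neq0 hp qP) ?i0.
Qed.

Lemma prodA_neq0 : \prod_(1 <= i < s) cA i != 0.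
Proof.
by rewrite big_nat prodf_seq_neq0; apply/allP=> i _; apply/implyP/cA_neq0.
Qed.

Lemma prodD_neq0 : \prod_(1 <= i < p - s) cD i != 0.
Proof.
by rewrite big_nat prodf_seq_neq0; apply/allP=> i _; apply/implyP/cD_neq0.
Qed.

Local Notation g := (gamma p q b s).

Lemma gammaE : g = (2 * p)%:R * (\prod_(1 <= i < p - s) cD i)
  * (\prod_(1 <= i < s) cA i).
Proof. by []. Qed.

Lemma gamma_neq0 : g != 0.
Proof.
rewrite gammaE !mulf_neq0 ?prodA_neq0 ?prodD_neq0 //.
exact: natr2p_neq0 qP.
Qed.

Local Notation r := (delta p q b s / g).

(** Multiplied by 2p, this is the polynomial G of the overview. *)
Definition idem_poly : {poly C} := g^-1 *: ((1 - r *: 'X) * AD).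

Lemma idemE : e = phi idem_poly * v.
Proof.
rewrite /idem b0E a0E scalerAl -cas_evalZ -[_ - _ * v]mulrBl -rmorphB scalerAl -cas_evalZ.
by rewrite /idem_poly mulrBl mul1r scalerAl.
Qed.

Lemma deltaE : delta p q b s =
  (2 * p)%:R * (\prod_(1 <= i < p - s) cD i)
    * (\sum_(1 <= j < s) \prod_(1 <= k < s | k != j) cA k)
  + (2 * p)%:R * (\prod_(1 <= i < s) cA i)
    * (\sum_(1 <= j < p - s) \prod_(1 <= k < p - s | k != j) cD k).
Proof. by []. Qed.

Lemma idem_poly_expand : exists H, (2 * p)%:R *: idem_poly = 1 + H * 'X^2.
Proof.
have [RA EA] := linprod_expand cA s; have [RD ED] := linprod_expand cD (p - s).
have N0 := natr2p_neq0 qP; have a0 := prodA_neq0; have d0 := prodD_neq0.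
rewrite /idem_poly EA ED deltaE gammaE.
move: (\sum_(1 <= j < s) _) (\sum_(1 <= j < p - s) _) N0 a0 d0.
move: (\prod_(1 <= i < s) cA i) (\prod_(1 <= i < p - s) cD i) (2 * p)%:R.
move=> a d N a1 d1 N0 a0 d0.
(* [t] is the logarithmic derivative of A D at 0 and equals delta / gamma, so 1 - t X inverts A D
   modulo X^2 up to the constant a d. *)
pose k := (a * d)^-1; pose t := a1 / a + d1 / d.
pose R := a%:P * RD + (a1 * d1)%:P + RA * d%:P
  + (a1%:P * RD + d1%:P * RA) * 'X + RA * RD * 'X^2.
(* The first term comes from (1 - t X) (1 + t X) = 1 - t^2 X^2, the second from the tail [R] of A
   D. *)
exists (- (t%:P ^+ 2) + k%:P * R * (1 - t%:P * 'X)).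
have -> : (N * d * a1 + N * a * d1) / (N * d * a) = t.
  by rewrite /t; field; rewrite a0 d0 N0.
have -> : (a%:P + a1%:P * 'X + RA * 'X^2) * (d%:P + d1%:P * 'X + RD * 'X^2)
    = (a * d)%:P * (1 + t%:P * 'X) + R * 'X^2.
  have -> : (a * d)%:P * (1 + t%:P * 'X) = (a * d)%:P + (a * d * t)%:P * 'X.
    by rewrite [(a * d * t)%:P]rmorphM /=; ring.
  have -> : a * d * t = a * d1 + d * a1 by rewrite /t; field; rewrite a0 d0.
  by rewrite /R !rmorphD !rmorphM /=; ring.
rewrite scalerA; have -> : N * (N * d * a)^-1 = k.
  by rewrite /k; field; rewrite a0 d0 N0.
have kad : k%:P * (a * d)%:P = 1 by rewrite -rmorphM mulVf ?mulf_neq0.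
rewrite -!mul_polyC; transitivity
  (k%:P * (a * d)%:P * ((1 - t%:P * 'X) * (1 + t%:P * 'X))
   + k%:P * R * (1 - t%:P * 'X) * 'X^2).
  by ring.
by rewrite kad; ring.
Qed.

(** The correction by [r] contributes a multiple of X^2 A D, which kills v. *)
Lemma nil_idem : phi 'X * e = g^-1 *: a0 q hp b s.
Proof.
rewrite idemE a0E mulrA -rmorphM.
have -> : 'X * idem_poly = g^-1 *: ('X * AD) - (g^-1 * r) *: ('X^2 * AD).
  rewrite /idem_poly -!mul_polyC rmorphM /=; ring.
rewrite (rmorphB phi) /= !cas_evalZ [LHS]mulrBl -!scalerAl nil2_AD; last exact: v_weight.
by rewrite scaler0 subr0.
Qed.

Lemma nil_idem_neq0 : phi 'X * e != 0.
Proof.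
rewrite nil_idem scaler_eq0 invr_eq0 (negPf gamma_neq0) /= /a0 vsumE.
exact: weight_EF_neq0 hp qP _ lamX.
Qed.

Lemma nil2_idem : phi 'X^2 * e = 0.
Proof.
rewrite idemE mulrA -rmorphM /idem_poly.
have -> : 'X^2 * (g^-1 *: ((1 - r *: 'X) * AD))
  = (g^-1 *: (1 - r *: 'X)) * ('X^2 * AD) by rewrite -!mul_polyC; ring.
rewrite rmorphM -[LHS]mulrA nil2_AD ?mulr0 //; exact: v_weight.
Qed.

Lemma E_nil_idem : E * (phi 'X * e) = 0.
Proof.
have [[Ep _ _] _] := Uq_relations q hp.
rewrite nil_idem -scalerAr /a0 !mulrA -exprS subn1 prednK ?(ltnW hp) //.
by rewrite Ep !mul0r scaler0.
Qed.

(** On F^s x the polynomial X D acts as E^(p-s) F^(p-s), which gives zero because F^(p-s) F^s =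
    F^p. *)
Lemma F_nil_AD x : weight lam x -> F ^+ s * (phi ('X * AD) * x) = 0.
Proof.
move=> lx; have [s0 sp] := andP hs; have [[_ Fp _] _] := Uq_relations q hp.
have q0 := q_neq0 hp qP.
pose m := q ^- (2 * s) * lam; have m0 : m != 0.
  by rewrite mulf_neq0 ?lam_neq0 ?invr_eq0 ?expf_neq0.
have qm : q * m = tlam / q ^+ (2 * s) by rewrite /m -q_lam; ring.
have tV : q * m = tlam^-1.
  rewrite qm /tlam invfM sgnV mulnC exprM; field.
  by rewrite expf_neq0.
have := weight_EF_exp qP (p - s) m0 (weightF_exp s lx).
rewrite [F ^+ (p - s) * _]mulrA -exprD subnK; last exact: ltnW.
have -> : linprod (fun i => bt (q * m) - bt (q * m / q ^+ (2 * i))) (p - s).+1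
    = linprod cD (p - s) * 'X.
  have -> : linprod cD (p - s) * 'X = linprod cD (p - s).+1.
    by rewrite linprodS ?subn_gt0 // /cD subnn qint0 !mulr0 addr0.
  apply: eq_big_nat => i /andP[_ ip]; rewrite -bt_hi //; congr (_ + (_ - _)%:P).
    by rewrite tV bt_neg.
  by rewrite qm mulnDr exprD invfM mulrA.
(* The weight after F^s has parameter 1 / [tlam], which gives the same Casimir value. *)
have -> : cas_eval q hp (q * m) = phi by rewrite tV /cas_eval bt_neg.
rewrite Fp mul0r mulr0 => XD0; rewrite mulrA -(cas_evalC qP) -[LHS]mulrA.
have -> : 'X * AD = linprod cA s * (linprod cD (p - s) * 'X) by ring.
by rewrite rmorphM -[LHS]mulrA -XD0 mulr0.
Qed.

Lemma F_nil_idem : F ^+ s * (phi 'X * e) = 0.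
Proof.
by rewrite nil_idem a0E -scalerAr F_nil_AD ?scaler0 //; apply: v_weight.
Qed.

Lemma idem_weight : weight lam e.
Proof. by rewrite idemE; apply/weight_cas_eval/v_weight. Qed.

(** On weight [lam] the sum v acts as 2p, and 2p times [idem_poly] is 1 modulo X^2. *)
Lemma idem_id x : weight lam x -> phi 'X^2 * x = 0 -> e * x = x.
Proof.
move=> lx x2; rewrite idemE -[LHS]mulrA (wsum_weight _ lx) divff ?lam_neq0 //.
under eq_bigr do rewrite expr1n.
rewrite sumr_const card_ord -scalerAr scalerAl -cas_evalZ.
have [H ->] := idem_poly_expand.
by rewrite rmorphD rmorph1 rmorphM [LHS]mulrDl mul1r -[_ * x]mulrA x2 mulr0 addr0.
Qed.

(** On weight [m] the sum v acts as the geometric sum of [m / lam], a nontrivial 2p-th root of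
    unity. *)
Lemma idem_orth m x : weight m x -> m ^+ (2 * p) = 1 -> m != lam -> e * x = 0.
Proof.
move=> mx mX ml; rewrite idemE -[LHS]mulrA (wsum_weight _ mx).
rewrite (sum_root_of_unity (n := 2 * p)) ?scale0r ?mulr0 //.
  by rewrite expr_div_n mX lamX divr1.
by apply: contra_neq ml => m1; rewrite -[m](divfK lam_neq0) m1 mul1r.
Qed.


Lemma cas_eval_linprodX c n x : phi 'X^2 * x = 0 ->
  phi (linprod c n * 'X) * x = (\prod_(1 <= i < n) c i) *: (phi 'X * x).
Proof.
move=> x2; have [R ->] := linprod_expand c n.
set a := \prod_(_ <= _ < _) _; set d := \sum_(_ <= _ < _) _.
have -> : (a%:P + d%:P * 'X + R * 'X^2) * 'X =
    a *: 'X + (d%:P + R * 'X) * 'X^2 by rewrite -mul_polyC; ring.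
rewrite rmorphD [LHS]mulrDl rmorphM -[_ * x in X in _ + X]mulrA x2 mulr0 addr0.
by rewrite /= cas_evalZ scalerAl.
Qed.

(** The factor at index s is X; the remaining constant is the one that normalizes X_0 in the dual
    corner. *)
Lemma EF_exp_idem : E ^+ s * (F ^+ s * e) = (\prod_(1 <= i < s) cA i) *: (phi 'X * e).
Proof.
rewrite mulrA uEF_v; last exact: idem_weight.
have -> : linprod zl s.+1 = linprod cA s * 'X.
  by rewrite -(addn1 s) linprod_hi // [linprod cD 1]big_geq // mulr1.
exact/cas_eval_linprodX/nil2_idem.
Qed.

Lemma FE_exp_idem : F ^+ (p - s) * (E ^+ (p - s) * e) =
  (\prod_(1 <= i < p - s) cD i) *: (phi 'X * e).
Proof.
rewrite (weight_FE_exp qP _ lam_neq0 idem_weight) q_lam -cas_eval_linprodX ?nil2_idem //.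
congr (phi _ * _); rewrite big_ltn; last by rewrite subn_gt0; case/andP: hs.
rewrite muln0 mulr1 subrr addr0 mulrC; congr (_ * _).
by apply: eq_big_nat => i /andP[_ /ltnW ip]; rewrite bt_up.
Qed.

Lemma FE_idem : F * E * e = phi 'X * e.
Proof.
rewrite -mulrA (weight_FE qP lam_neq0 idem_weight) q_lam (cas_eval_shift tlam).
by rewrite subrr addr0.
Qed.

End Idempotent.

(** * Products in a pair of linked corners *)

Section Pair.
Variables (C : fieldType) (p : nat) (q : C).
Hypotheses (hp : (1 < p)%N) (qP : (2 * p).-primitive_root q).

Local Notation U := (Uq q hp).
Local Notation E := (@uE C p q hp).
Local Notation F := (@uF C p q hp).
Local Notation e := (idem q hp).

Definition cX (b : bool) (s : nat) : C :=
  \prod_(1 <= l < s) (- (-1) ^+ b * (qint q l * qint q (s - l))).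
Definition vX (b : bool) s s' : U := (cX b s')^-1 *: (E ^+ s' * e b s).
Definition vY (b : bool) s : U := F ^+ s * e b s.
Definition vA (b : bool) s : U := F * E * e b s.

(* (b, s, s') = (false, s, p - s) gives X_0^+, Y_0^+, A_0^+, while (true, p - s, s)
   gives X_0^-, Y_0^-, A_0^-. *)
Section Generic.
Variables (b : bool) (s s' : nat).
Hypotheses (s0 : (0 < s)%N) (s'0 : (0 < s')%N) (ss' : (s + s')%N = p).

Local Notation phi := (cas_eval q hp (tlam q b s)).
Local Notation l := (lam q b s).
Local Notation l' := (lam q (~~ b) s').

Let q0 : q != 0 := q_neq0 hp qP.
Let hs : (0 < s < p)%N. Proof. by rewrite s0 -ss' -[X in (X < _)%N]addn0 ltn_add2l. Qed.
Let hs' : (0 < s' < p)%N. Proof. by rewrite s'0 -ss' -[X in (X < _)%N]add0n ltn_add2r. Qed.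
Let ps : (p - s)%N = s'. Proof. by rewrite -ss' addKn. Qed.

(** This rests on [q ^+ p = -1]. Since the Casimir value is invariant under inversion, the two
    linked idempotents lie in the same block. *)
Lemma tlam_dual : tlam q (~~ b) s' = (tlam q b s)^-1.
Proof.
rewrite /tlam invfM sgnV signrN mulNr -mulrN; congr (_ * _).
apply: (mulIf (expf_neq0 s q0)); rewrite mulVf ?expf_neq0 //.
by rewrite mulNr -exprD addnC ss' (qXp hp qP) opprK.
Qed.

Lemma cas_eval_dual : cas_eval q hp (tlam q (~~ b) s') = phi.
Proof. by rewrite tlam_dual /cas_eval bt_neg. Qed.

Lemma lam_dualF : l' = q ^- (2 * s) * l.
Proof.
apply: (mulfI q0); rewrite (q_lam _ _ hs') tlam_dual mulrCA (q_lam _ _ hs) /tlam.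
rewrite invfM sgnV mulnC exprM; field.
by rewrite expf_neq0.
Qed.

Lemma lam_dualE : l' = q ^+ (2 * s') * l.
Proof.
rewrite lam_dualF; congr (_ * _); apply: (mulIf (expf_neq0 (2 * s) q0)).
by rewrite mulVf ?expf_neq0 // -exprD -mulnDr addnC ss' (qX2p qP).
Qed.

Lemma lamE_eq k m : (q ^+ (2 * k) * l == q ^+ (2 * m) * l) = (k == m %[mod p])%N.
Proof. by rewrite (inj_eq (mulIf (lam_neq0 hp qP b s))) (q2X_eq qP). Qed.

Lemma lamF_eq k m : (q ^- (2 * k) * l == q ^- (2 * m) * l) = (k == m %[mod p])%N.
Proof.
by rewrite (inj_eq (mulIf (lam_neq0 hp qP b s))) (inj_eq invr_inj) (q2X_eq qP).
Qed.

Lemma lam_dual_neq : l' != l.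
Proof.
rewrite lam_dualE -[X in _ != X]mul1r -[X in _ != X * _](expr0 q) -(muln0 2) lamE_eq.
by rewrite mod0n modn_small ?gtn_eqF //; case/andP: hs'.
Qed.

Lemma cas_eval_nil2 x : phi 'X^2 * (x * e b s) = 0.
Proof. by rewrite mulrA (cas_evalC qP) -mulrA (nil2_idem hp qP) ?mulr0. Qed.

Lemma weightX : weight l' (vX b s s').
Proof. by rewrite lam_dualE; apply/weightZ/weightE_exp/idem_weight. Qed.

Lemma weightY : weight l' (vY b s).
Proof. by rewrite lam_dualF; apply/weightF_exp/idem_weight. Qed.

Lemma vAE : vA b s = phi 'X * e b s.
Proof. exact: FE_idem. Qed.

Lemma vA_neq0 : vA b s != 0.
Proof. by rewrite vAE; apply: nil_idem_neq0. Qed.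

Lemma idem_idem : e b s * e b s = e b s.
Proof.
apply: (idem_id qP hs); first exact: (idem_weight hp qP).
exact: (nil2_idem hp qP).
Qed.

Lemma idem_dual0 : e b s * e (~~ b) s' = 0.
Proof.
apply: (idem_orth qP hs (m := l')) (lamX qP _ _) lam_dual_neq.
exact: (idem_weight hp qP).
Qed.

Lemma idem_vX : e (~~ b) s' * vX b s s' = vX b s s'.
Proof.
apply: (idem_id qP hs'); first exact: weightX.
by rewrite cas_eval_dual -scalerAr cas_eval_nil2 scaler0.
Qed.

Lemma idem_vY : e (~~ b) s' * vY b s = vY b s.
Proof.
apply: (idem_id qP hs'); first exact: weightY.
by rewrite cas_eval_dual cas_eval_nil2.
Qed.

Lemma idem_vA : e b s * vA b s = vA b s.
Proof. by rewrite vAE mulrA -(cas_evalC qP) -mulrA idem_idem. Qed.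

Lemma vX_idem : vX b s s' * e b s = vX b s s'.
Proof. by rewrite -scalerAl -mulrA idem_idem. Qed.

Lemma vY_idem : vY b s * e b s = vY b s.
Proof. by rewrite -[LHS]mulrA idem_idem. Qed.

Lemma vA_idem : vA b s * e b s = vA b s.
Proof. by rewrite -[LHS]mulrA idem_idem. Qed.

Lemma vA_vA : vA b s * vA b s = 0.
Proof.
by rewrite {1}vAE -[LHS]mulrA idem_vA vAE mulrA -rmorphM -expr2 (nil2_idem hp qP).
Qed.

Lemma vX_vA : vX b s s' * vA b s = 0.
Proof.
rewrite -scalerAl -mulrA idem_vA vAE; case: s' s'0 => // k _.
by rewrite exprSr -mulrA (E_nil_idem hp qP) // mulr0 scaler0.
Qed.

Lemma vY_vA : vY b s * vA b s = 0.
Proof. by rewrite -[LHS]mulrA idem_vA vAE (F_nil_idem hp qP). Qed.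

Lemma cX_neq0 : cX b s' != 0.
Proof. by rewrite /cX -ps; apply: (prodD_neq0 hp qP _ hs). Qed.

Lemma dual_vY_vX : vY (~~ b) s' * vX b s s' = vA b s.
Proof.
rewrite -[LHS]mulrA idem_vX vAE /vX -scalerAr -ps (FE_exp_idem hp qP _ hs).
rewrite scalerA (_ : cX b (p - s) = \prod_(1 <= i < p - s) cD p q b s i) //.
by rewrite mulVf ?scale1r //; apply: (prodD_neq0 hp qP _ hs).
Qed.

Lemma dual_vX_vY : vX (~~ b) s' s * vY b s = vA b s.
Proof.
rewrite -scalerAl -[_ * vY b s]mulrA idem_vY vAE (EF_exp_idem hp qP _ hs) scalerA.
rewrite (_ : cX (~~ b) s = \prod_(1 <= i < s) cA q b s i); last first.
  by rewrite /cX signrN opprK.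
by rewrite mulVf ?scale1r //; apply: (prodA_neq0 hp qP _ hs).
Qed.

Lemma dual_vX_vX : vX (~~ b) s' s * vX b s s' = 0.
Proof.
have [[Ep _ _] _] := Uq_relations q hp.
rewrite -scalerAl -[_ * vX b s s']mulrA idem_vX -scalerAr mulrA -exprD ss' Ep.
by rewrite mul0r !scaler0.
Qed.

Lemma dual_vY_vY : vY (~~ b) s' * vY b s = 0.
Proof.
have [[_ Fp _] _] := Uq_relations q hp.
by rewrite -[LHS]mulrA idem_vY mulrA -exprD addnC ss' Fp mul0r.
Qed.

Lemma dual_vAE : vA (~~ b) s' = phi 'X * e (~~ b) s'.
Proof. by rewrite -cas_eval_dual; apply: FE_idem. Qed.

(** In the dual corner A_0 acts as the central element Y, which moves past the power of E and
    reduces the claim to [vX_vA]. *)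
Lemma dual_vA_vX : vA (~~ b) s' * vX b s s' = 0.
Proof.
rewrite dual_vAE -[LHS]mulrA idem_vX -scalerAr mulrA (cas_evalC qP) -mulrA -vAE.
by have /eqP := vX_vA; rewrite -scalerAl -mulrA idem_vA => /eqP.
Qed.

Lemma dual_vA_vY : vA (~~ b) s' * vY b s = 0.
Proof.
rewrite dual_vAE -[LHS]mulrA idem_vY mulrA (cas_evalC qP) -mulrA -vAE.
by have /eqP := vY_vA; rewrite -[_ * _]mulrA idem_vA => /eqP.
Qed.

(** Describes the left ideal generated by the idempotent. Scalars are absorbed into [P], so closure
    under sums suffices. *)
Inductive ideal_span : U -> Prop :=
  | ideal_spanE k P : ideal_span (E ^+ k * (phi P * e b s))
  | ideal_spanF k P : ideal_span (F ^+ k * (phi P * e b s))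
  | ideal_spanD x y : ideal_span x -> ideal_span y -> ideal_span (x + y).

Lemma idem_cas_eval_weight P : weight l (phi P * e b s).
Proof. by apply: (weight_cas_eval qP); apply: (idem_weight hp qP). Qed.

(** When E meets a positive power of F, or F one of E, the pair acts on a weight vector as a linear
    factor in Y, which joins [P]. *)
Lemma ideal_span_mul x u : ideal_span u -> ideal_span (x * u).
Proof.
have phi_in k (G : U) P Q : G ^+ k * (phi P * (phi Q * e b s)) =
    G ^+ k * (phi (P * Q) * e b s).
  by congr (_ * _); rewrite rmorphM mulrA.
have l0 := lam_neq0 hp qP b s.
elim/Uq_ind: x u => [|||a|x y IHx IHy|x y IHx IHy] u.
- elim=> [k P|[|k] P|x y _ IHx _ IHy].
  + by rewrite mulrA -exprS; constructor.
  + by rewrite expr0 mul1r -[E]expr1; constructor.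
  + rewrite exprS -[F * _ * _]mulrA.
    rewrite (weight_EF qP _ (weightF_exp k (idem_cas_eval_weight P))); last first.
      by rewrite mulf_neq0 ?invr_eq0 ?expf_neq0.
    by rewrite (cas_eval_shift (tlam q b s)) mulrA (cas_evalC qP) -mulrA phi_in; constructor.
  + by rewrite mulrDr; apply: ideal_spanD.
- elim=> [[|k] P|k P|x y _ IHx _ IHy].
  + by rewrite expr0 mul1r -[F]expr1; constructor.
  + rewrite exprS -[E * _ * _]mulrA.
    rewrite (weight_FE qP _ (weightE_exp k (idem_cas_eval_weight P))); last first.
      by rewrite mulf_neq0 ?expf_neq0.
    by rewrite (cas_eval_shift (tlam q b s)) mulrA (cas_evalC qP) -mulrA phi_in; constructor.
  + by rewrite mulrA -exprS; constructor.
  + by rewrite mulrDr; apply: ideal_spanD.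
- elim=> [k P|k P|x y _ IHx _ IHy].
  + rewrite (weightE_exp k (idem_cas_eval_weight P)) scalerAr [_ *: (_ * _)]scalerAl -cas_evalZ.
    by constructor.
  + rewrite (weightF_exp k (idem_cas_eval_weight P)) scalerAr [_ *: (_ * _)]scalerAl -cas_evalZ.
    by constructor.
  + by rewrite mulrDr; apply: ideal_spanD.
- elim=> [k P|k P|x y _ IHx _ IHy].
  + by rewrite mulr_algl scalerAr [_ *: (_ * _)]scalerAl -cas_evalZ; constructor.
  + by rewrite mulr_algl scalerAr [_ *: (_ * _)]scalerAl -cas_evalZ; constructor.
  + by rewrite mulrDr; apply: ideal_spanD.
- by move=> uS; rewrite [(x + y) * u]mulrDl; apply: ideal_spanD; [apply: IHx|apply: IHy].
by move=> uS; rewrite -mulrA; apply/IHx/IHy.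
Qed.

Lemma ideal_span_idem x : ideal_span (x * e b s).
Proof.
apply: ideal_span_mul; have := ideal_spanE 0 1.
by rewrite expr0 rmorph1 !mul1r.
Qed.

(** Two coefficients of [P] are peeled off; the rest is divisible by X^2 and kills the
    idempotent. *)
Lemma cas_eval_idem P : exists c d, phi P * e b s = c *: e b s + d *: vA b s.
Proof.
have [c [d [R ->]]] : exists c d R, P = c%:P + d *: 'X + R * 'X^2.
  elim/poly_ind: P => [|P c _].
    by exists 0, 0, 0; rewrite scale0r mul0r !addr0.
  elim/poly_ind: P => [|P d _].
    by exists c, 0, 0; rewrite scale0r !mul0r !addr0 add0r.
  by exists c, d, P; rewrite -mul_polyC; ring.
exists c, d; rewrite !rmorphD rmorphM /= cas_evalZ.
rewrite [LHS]mulrDl [X in X + _ = _]mulrDl -[phi R * _ * _]mulrA.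
rewrite (nil2_idem hp qP) // mulr0 addr0 -scalerAl -vAE.
by rewrite [cas_eval _ _ _ c%:P]horner_algC mulr_algl.
Qed.

Lemma uE_exp0 k : (p <= k)%N -> E ^+ k = 0.
Proof.
have [[Ep _ _] _] := Uq_relations q hp.
by move=> pk; rewrite -(subnK pk) exprD Ep mulr0.
Qed.

Lemma uF_exp0 k : (p <= k)%N -> F ^+ k = 0.
Proof.
have [[_ Fp _] _] := Uq_relations q hp.
by move=> pk; rewrite -(subnK pk) exprD Fp mulr0.
Qed.

Lemma lamEX k : (q ^+ (2 * k) * l) ^+ (2 * p) = 1.
Proof. by rewrite exprMn (qXX qP) (lamX qP) mulr1. Qed.

Lemma lamFX k : (q ^- (2 * k) * l) ^+ (2 * p) = 1.
Proof. by rewrite exprMn exprVn (qXX qP) (lamX qP) invr1 mulr1. Qed.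

(** For 0 < k < p the powers E^k and F^k change the weight, so the left idempotent kills these
    terms. *)
Lemma corner_same x : exists c d, e b s * x * e b s = c *: e b s + d *: vA b s.
Proof.
have eP P : exists c d, e b s * (phi P * e b s) = c *: e b s + d *: vA b s.
  by rewrite mulrA -(cas_evalC qP) -mulrA idem_idem; apply: cas_eval_idem.
have zero y : y = 0 -> exists c d, y = c *: e b s + d *: vA b s.
  by move=> ->; exists 0, 0; rewrite !scale0r addr0.
rewrite -[_ * x * _]mulrA.
elim: (ideal_span_idem x) => [k P|k P|y z _ [c [d IHy]] _ [c' [d' IHz]]].
- have [pk|kp] := leqP p k; first by apply: zero; rewrite uE_exp0 // mul0r mulr0.
  case: k kp => [|k] kp; first by rewrite expr0 mul1r.
  apply: zero; apply: (idem_orth qP hs (weightE_exp _ (idem_cas_eval_weight P))).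
    exact: lamEX.
  rewrite -[X in _ != X]mul1r -[X in _ != X * _](expr0 q) -(muln0 2) lamE_eq.
  by rewrite mod0n modn_small.
- have [pk|kp] := leqP p k; first by apply: zero; rewrite uF_exp0 // mul0r mulr0.
  case: k kp => [|k] kp; first by rewrite expr0 mul1r.
  apply: zero; apply: (idem_orth qP hs (weightF_exp _ (idem_cas_eval_weight P))).
    exact: lamFX.
  rewrite -[X in _ != X]mul1r -[X in _ != X * _]invr1 -(expr0 q) -(muln0 2) lamF_eq.
  by rewrite mod0n modn_small.
exists (c + c'), (d + d').
by rewrite [LHS]mulrDr IHy IHz !scalerDl addrACA.
Qed.

(** Among exponents below p, only E^(s') and F^s lead to the dual weight. *)
Lemma corner_dual x :
  exists c d, e (~~ b) s' * x * e b s = c *: vX b s s' + d *: vY b s.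
Proof.
have zero y : y = 0 -> exists c d, y = c *: vX b s s' + d *: vY b s.
  by move=> ->; exists 0, 0; rewrite !scale0r addr0.
have [s'p sp] : (s' < p)%N /\ (s < p)%N.
  by case/andP: hs => _ ->; case/andP: hs' => _ ->.
rewrite -[_ * x * _]mulrA.
elim: (ideal_span_idem x) => [k P|k P|y z _ [c [d IHy]] _ [c' [d' IHz]]].
- have [pk|kp] := leqP p k; first by apply: zero; rewrite uE_exp0 // mul0r mulr0.
  case: (eqVneq k s') => [->|ks]; last first.
    apply: zero; apply: (idem_orth qP hs' (weightE_exp _ (idem_cas_eval_weight P))).
      exact: lamEX.
    by rewrite lam_dualE lamE_eq !modn_small.
  have [c [d ->]] := cas_eval_idem P.
  (* The part of [P] linear in Y contributes nothing, so the constant coefficient decides. *)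
  have EA0 : E ^+ s' * vA b s = 0.
    have /eqP := vX_vA; rewrite -scalerAl -mulrA idem_vA scaler_eq0 invr_eq0.
    by rewrite (negPf cX_neq0) => /eqP.
  exists (c * cX b s'), 0; rewrite [E ^+ s' * _]mulrDr -[_ * (c *: _)]scalerAr.
  rewrite -[_ * (d *: _)]scalerAr EA0 scaler0 addr0 scale0r addr0.
  have -> : E ^+ s' * e b s = cX b s' *: vX b s s'.
    by rewrite scalerA mulfV ?scale1r ?cX_neq0.
  by rewrite scalerA -scalerAr idem_vX.
- have [pk|kp] := leqP p k; first by apply: zero; rewrite uF_exp0 // mul0r mulr0.
  case: (eqVneq k s) => [->|ks]; last first.
    apply: zero; apply: (idem_orth qP hs' (weightF_exp _ (idem_cas_eval_weight P))).
      exact: lamFX.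
    by rewrite lam_dualF lamF_eq !modn_small.
  have [c [d ->]] := cas_eval_idem P.
  have FA0 : F ^+ s * vA b s = 0.
    by have := vY_vA; rewrite -[LHS]mulrA idem_vA.
  exists 0, c; rewrite [F ^+ s * _]mulrDr -[_ * (c *: _)]scalerAr.
  rewrite -[_ * (d *: _)]scalerAr FA0 scaler0 addr0 scale0r add0r.
  by rewrite -/(vY b s) -scalerAr idem_vY.
exists (c + c'), (d + d').
by rewrite [LHS]mulrDr IHy IHz !scalerDl addrACA.
Qed.

End Generic.
End Pair.

(** * The basic algebra *)

Lemma bindex_decodeK : cancel (fun k : 'I_8 => nth I_ep bindex_seq k) bindex_code.
Proof. by case=> [] [|[|[|[|[|[|[|[|k]]]]]]]] // lt; apply/val_inj; rewrite /= inordK. Qed.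

Lemma card_bindex : #|{: bindex}| = 8%N.
Proof.
rewrite -[RHS]card_ord; apply: (bij_eq_card (f := bindex_code)).
exact: Bijective bindex_codeK bindex_decodeK.
Qed.

Lemma big_bindex (V : zmodType) (f : bindex -> V) :
  \sum_i f i = f I_ep + (f I_em + (f I_Xp + (f I_Xm +
    (f I_Yp + (f I_Ym + (f I_Ap + f I_Am)))))).
Proof.
rewrite (reindex (fun k : 'I_8 => nth I_ep bindex_seq k)) /=; last first.
  by exists bindex_code => i _; rewrite ?bindex_codeK ?bindex_decodeK.
by rewrite !big_ord_recl big_ord0 addr0.
Qed.

Section BasicAlgebra.
Variables (C : fieldType) (p : nat) (q : C).
Hypotheses (hp : (1 < p)%N) (qP : (2 * p).-primitive_root q).
Variable s : nat.
Hypothesis hs : (0 < s < p)%N.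

Local Notation U := (Uq q hp).
Local Notation s' := (p - s)%N.
Local Notation v := (bvec q hp s).
Local Notation ep := (idem q hp false s).
Local Notation em := (idem q hp true s').
Local Notation corner := (corner_idem q hp s).
Local Notation B := (basic_algebra q hp s).

Let s0 : (0 < s)%N. Proof. by case/andP: hs. Qed.
Let s'0 : (0 < s')%N. Proof. by rewrite subn_gt0; case/andP: hs. Qed.
Let ss' : (s + s')%N = p. Proof. by rewrite subnKC //; case/andP: hs => _ /ltnW. Qed.
Let s's : (s' + s)%N = p. Proof. by rewrite addnC. Qed.

Lemma XpE : Xp q hp s = vX q hp false s s'.
Proof.
rewrite /Xp /vX /cX; congr (_^-1 *: _); apply: eq_bigr => i _.
by rewrite expr0 mulN1r.
Qed.

Lemma XmE : Xm q hp s = vX q hp true s' s.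
Proof.
rewrite /Xm /vX /cX; congr (_^-1 *: _); apply: eq_bigr => i _.
by rewrite expr1 opprK mul1r.
Qed.

Lemma bvecM i j : v i * v j = if btable i j is Some k then v k else 0.
Proof.
have ee := idem_idem hp qP false s0 s'0 ss'.
have ff := idem_idem hp qP true s'0 s0 s's.
have ef := idem_dual0 hp qP false s0 s'0 ss'.
have fe := idem_dual0 hp qP true s'0 s0 s's.
have fX := idem_vX hp qP false s0 s'0 ss'. have eX' := idem_vX hp qP true s'0 s0 s's.
have fY := idem_vY hp qP false s0 s'0 ss'. have eY' := idem_vY hp qP true s'0 s0 s's.
have eA1 := idem_vA hp qP false s0 s'0 ss'. have fA := idem_vA hp qP true s'0 s0 s's.
have Xe1 := vX_idem hp qP false s0 s'0 ss'. have Xf := vX_idem hp qP true s'0 s0 s's.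
have Ye1 := vY_idem hp qP false s0 s'0 ss'. have Yf := vY_idem hp qP true s'0 s0 s's.
have Ae1 := vA_idem hp qP false s0 s'0 ss'. have Af := vA_idem hp qP true s'0 s0 s's.
rewrite /= in ef fe fX eX' fY eY'.
have tgt k : (if k is (I_ep | I_Xm | I_Ym | I_Ap) then ep else em) * v k = v k.
  by case: k => //=; rewrite ?XpE ?XmE.
have src k : v k * (if k is (I_ep | I_Xp | I_Yp | I_Ap) then ep else em) = v k.
  by case: k => //=; rewrite ?XpE ?XmE.
(* [tgt] and [src] place each basis vector in a corner; a product is zero when the two idempotents
   that meet in the middle are orthogonal. The remaining entries are the facts in the context. *)
have st k m : (if k is (I_ep | I_Xp | I_Yp | I_Ap) then ep else em) *
    (if m is (I_ep | I_Xm | I_Ym | I_Ap) then ep else em) = 0 -> v k * v m = 0.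
  by move=> km; rewrite -(src k) -(tgt m) mulrA -[v k * _ * _]mulrA km mulr0 mul0r.
have EA1 := vX_vA hp qP false s0 s'0 ss'. have FA1 := vY_vA hp qP false s0 s'0 ss'.
have EA2 := vX_vA hp qP true s'0 s0 s's. have FA2 := vY_vA hp qP true s'0 s0 s's.
have AA1 := vA_vA hp qP false s0 s'0 ss'. have AA2 := vA_vA hp qP true s'0 s0 s's.
have YX1 := dual_vY_vX hp qP false s0 s'0 ss'. have YX2 := dual_vY_vX hp qP true s'0 s0 s's.
have XY1 := dual_vX_vY hp qP false s0 s'0 ss'. have XY2 := dual_vX_vY hp qP true s'0 s0 s's.
have XX1 := dual_vX_vX hp qP false s0 s'0 ss'. have XX2 := dual_vX_vX hp qP true s'0 s0 s's.
have YY1 := dual_vY_vY hp qP false s0 s'0 ss'. have YY2 := dual_vY_vY hp qP true s'0 s0 s's.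
have AX1 := dual_vA_vX hp qP false s0 s'0 ss'. have AX2 := dual_vA_vX hp qP true s'0 s0 s's.
have AY1 := dual_vA_vY hp qP false s0 s'0 ss'. have AY2 := dual_vA_vY hp qP true s'0 s0 s's.
by case: i; case: j;
  first [by apply: st; first [exact: ef | exact: fe] | rewrite /= ?XpE ?XmE].
Qed.

Lemma Ap_neq0 : v I_Ap != 0.
Proof. exact: (vA_neq0 hp qP false s0 s'0 ss'). Qed.

Lemma Am_neq0 : v I_Am != 0.
Proof. exact: (vA_neq0 hp qP true s'0 s0 s's). Qed.

Lemma bvec_mul_sum j (c : bindex -> C) :
  v j * (\sum_i c i *: v i) =
  \sum_i c i *: (if btable j i is Some k then v k else 0).
Proof. by rewrite mulr_sumr; apply: eq_bigr => i _; rewrite -scalerAr bvecM. Qed.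

Lemma bvec_sum_mul j (c : bindex -> C) :
  (\sum_i c i *: v i) * v j =
  \sum_i c i *: (if btable i j is Some k then v k else 0).
Proof. by rewrite mulr_suml; apply: eq_bigr => i _; rewrite -scalerAl bvecM. Qed.

(** Multiplying by a basis vector isolates a coefficient in front of A_0^+ or A_0^-. The idempotents
    come first because their coefficients reappear in the later products. *)
Lemma bvec_free (c : bindex -> C) : \sum_i c i *: v i = 0 -> forall i, c i = 0.
Proof.
move=> c0.
have L j : \sum_i c i *: (if btable j i is Some k then v k else 0) = 0.
  by rewrite -bvec_mul_sum c0 mulr0.
have R j : \sum_i c i *: (if btable i j is Some k then v k else 0) = 0.
  by rewrite -bvec_sum_mul c0 mul0r.
have A1 a : a *: v I_Ap = 0 -> a = 0.
  by move/eqP; rewrite scaler_eq0 (negPf Ap_neq0) orbF => /eqP.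
have A2 a : a *: v I_Am = 0 -> a = 0.
  by move/eqP; rewrite scaler_eq0 (negPf Am_neq0) orbF => /eqP.
have simp := (scaler0, addr0, add0r, scale0r).
have cep : c I_ep = 0 by move: (L I_Ap); rewrite big_bindex /= !simp; apply: A1.
have cem : c I_em = 0 by move: (L I_Am); rewrite big_bindex /= !simp; apply: A2.
have cXp : c I_Xp = 0.
  by move: (L I_Ym); rewrite big_bindex /= cem !simp; apply: A1.
have cYp : c I_Yp = 0.
  by move: (L I_Xm); rewrite big_bindex /= cem !simp; apply: A1.
have cXm : c I_Xm = 0.
  by move: (L I_Yp); rewrite big_bindex /= cep !simp; apply: A2.
have cYm : c I_Ym = 0.
  by move: (L I_Xp); rewrite big_bindex /= cep !simp; apply: A2.
have cAp : c I_Ap = 0.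
  by move: (R I_ep); rewrite big_bindex /= cep cXp cYp !simp; apply: A1.
have cAm : c I_Am = 0.
  by move: (R I_em); rewrite big_bindex /= cem cXm cYm !simp; apply: A2.
by case.
Qed.

Lemma corner_bvec i : corner * v i = v i /\ v i * corner = v i.
Proof.
rewrite /corner_idem -[ep]/(v I_ep) -[em]/(v I_em).
split.
  by rewrite [LHS]mulrDl !bvecM; case: i => /=; rewrite ?addr0 ?add0r.
by rewrite [LHS]mulrDr !bvecM; case: i => /=; rewrite ?addr0 ?add0r.
Qed.

Local Notation N := (casimir q hp - (beta q s)%:A).

Lemma NE : N = cas_eval q hp (tlam q false s) 'X.
Proof.
by rewrite /cas_eval horner_algX /casimir_val /beta /tlam expr0 mul1r.
Qed.

Lemma bvec_block i : block q hp s (v i).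
Proof.
(* Exponent 2 suffices, since the square of Y kills both idempotents and hence their left
   multiples. *)
exists 2; rewrite NE -rmorphXn.
have nil1 x : cas_eval q hp (tlam q false s) 'X^2 * (x * ep) = 0.
  exact: (cas_eval_nil2 qP false s0 s'0 ss').
have nil2 x : cas_eval q hp (tlam q false s) 'X^2 * (x * em) = 0.
  rewrite -(cas_eval_dual hp qP false ss') /=.
  exact: (cas_eval_nil2 qP true s'0 s0 s's).
case: i.
- by rewrite -[v _]mul1r nil1.
- by rewrite -[v _]mul1r nil2.
- by rewrite /= /Xp scalerAl nil1.
- by rewrite /= /Xm scalerAl nil2.
- exact: nil1.
- exact: nil2.
- exact: nil1.
- exact: nil2.
Qed.

Lemma bvec_basic i : B (v i).
Proof.
exists (v i); first exact: bvec_block.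
by have [cv vc] := corner_bvec i; rewrite cv vc.
Qed.

(** Peirce decomposition into four corners, each spanned by two basis vectors. *)
Lemma corner_span x : exists c : bindex -> C, corner * x * corner = \sum_i c i *: v i.
Proof.
have [a1 [a2 Ea]] := corner_same qP false s0 s'0 ss' x.
have [b1 [b2 Eb]] := corner_same qP true s'0 s0 s's x.
have [c1 [c2 Ec]] := corner_dual qP false s0 s'0 ss' x.
have [d1 [d2 Ed]] := corner_dual qP true s'0 s0 s's x.
rewrite /= in Ec Ed.
exists (fun i => match i with
  | I_ep => a1 | I_Ap => a2 | I_em => b1 | I_Am => b2
  | I_Xp => c1 | I_Yp => c2 | I_Xm => d1 | I_Ym => d2 end).
rewrite big_bindex /= XpE XmE.
have -> : corner * x * corner =
    (ep * x * ep + em * x * ep) + (ep * x * em + em * x * em).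
  rewrite /corner_idem [LHS]mulrDr -[X in X + _]mulrA -[X in _ + X]mulrA.
  by rewrite [X in X + _]mulrDl [X in _ + X]mulrDl !mulrA.
rewrite Ea Eb Ec Ed.
by rewrite (AC ((2 * 2) * (2 * 2)) (1 * (7 * (3 * (5 * (4 * (6 * (2 * 8)))))))).
Qed.

Lemma block_linear a x y :
  block q hp s x -> block q hp s y -> block q hp s (a *: x + y).
Proof.
move=> [n xn] [m ym]; exists (n + m)%N.
rewrite [LHS]mulrDr -scalerAr {1}addnC !exprD -[_ * x]mulrA xn mulr0 scaler0 add0r.
by rewrite -mulrA ym mulr0.
Qed.

Lemma basic_algebra_unital : is_algebra_with_unit B corner.
Proof.
have cc : corner * corner = corner.
  rewrite {2 3}/corner_idem [LHS]mulrDr.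
  by have [-> _] := corner_bvec I_ep; have [-> _] := corner_bvec I_em.
split.
- exists corner; last by rewrite !cc.
  rewrite /corner_idem -[ep]scale1r.
  exact: block_linear (bvec_block I_ep) (bvec_block I_em).
- by move=> _ [x _ <-]; split; [rewrite !mulrA cc | rewrite -!mulrA cc].
- move=> a _ _ [x xn <-] [y yn <-]; exists (a *: x + y); first exact: block_linear.
  rewrite [corner * (_ + _)]mulrDr [LHS]mulrDl -[corner * (a *: x)]scalerAr.
  by rewrite [in RHS]scalerAl.
- move=> _ _ [x [n xn] <-] [y _ <-].
  exists (x * corner * (corner * y)); last by rewrite !mulrA.
  by exists n; rewrite !mulrA xn !mul0r.
Qed.

Lemma bvec_basis : is_basis B v.
Proof.
split; first exact: bvec_basic.
  exact: bvec_free.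
by move=> _ [x _ <-]; apply: corner_span.
Qed.

End BasicAlgebra.

(** * The primitivity of q = exp(pi i / p) *)

Section RootQ.
Variables (R : realType) (p : nat).
Hypothesis hp : (1 < p)%N.

(** De Moivre's formula, from the addition theorems. *)
Lemma root_qX n :
  root_q R p ^+ n = Complex (cos (n%:R * (pi / p%:R))) (sin (n%:R * (pi / p%:R))).
Proof.
elim: n => [|n IHn]; first by rewrite !mul0r cos0 sin0.
rewrite exprS IHn /root_q; simpc.
have -> : n.+1%:R * (pi / p%:R) = pi / p%:R + n%:R * (pi / p%:R) :> R.
  by rewrite -[n.+1%:R]natr1 mulrDl mul1r addrC.
by rewrite cosD sinD; congr Complex; rewrite addrC.
Qed.

Lemma root_q_prim : (2 * p).-primitive_root (root_q R p).
Proof.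
have p0 : (0 < p)%N := ltnW hp.
have pR : p%:R != 0 :> R by rewrite pnatr_eq0 -lt0n.
have pi0 := pi_gt0 R.
apply/andP; split; first by rewrite muln_gt0.
apply/forallP=> i; apply/eqP; rewrite unity_rootE root_qX.
have [->|ip] := eqVneq i.+1 (2 * p)%N.
  have -> : (2 * p)%:R * (pi / p%:R) = pi *+ 2 :> R.
    by rewrite natrM mulr_natl; field.
  by rewrite cos2pi sin2pi eqxx.
(* For an exponent below 2p, x / 2 lies strictly between 0 and pi, so the real part 1 - 2 sin^2(x /
   2) is less than 1. *)
apply/negbTE/eqP=> /(congr1 (@complex.Re R)) /=.
set x := i.+1%:R * (pi / p%:R).
have -> : x = (x / 2) *+ 2 by rewrite -mulr_natr divfK.
have : 0 < sin (x / 2).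
  apply: sin_gt0_pi; apply/andP; split.
    by rewrite divr_gt0 // /x mulr_gt0 ?ltr0n // divr_gt0 ?ltr0n.
  rewrite ltr_pdivrMr // /x mulrA ltr_pdivrMr ?ltr0n //.
  rewrite mulrC -mulrA ltr_pM2l // -natrM ltr_nat.
  by rewrite ltn_neqAle ip; apply: ltn_ord.
rewrite cos_mulr2n cos2sin2 => s0 c1.
by have := exprn_gt0 2 s0; lra.
Qed.

End RootQ.

Theorem theorem4p3 (R : realType) (p : nat) (hp : (1 < p)%N) (s : nat)
    (hs : (1 <= s <= p - 1)%N) :
  let q : R[i] := root_q R p in
  let B := basic_algebra q hp s in
  let v := bvec q hp s in
  [/\ is_algebra_with_unit B (corner_idem q hp s),
      #|{: bindex}| = 8%N,
      is_basis B v &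
      forall i j, v i * v j = if btable i j is Some k then v k else 0].
Proof.
have qP := root_q_prim R hp.
have hs1 : (0 < s < p)%N by lia.
split.
- exact: basic_algebra_unital.
- exact: card_bindex.
- exact: bvec_basis.
- exact: bvecM.
Qed.
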